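(* For $n\in\mathbb{N}$, let $(\mu_n,\nu_n)\in\mathcal{P}(\mathcal{X})\times\mathcal{P}(\mathcal{Y})$ satisfy $\mathcal{C}(\mu_n,\nu_n)<\infty$, let $\pi_n\in\Pi(\mu_n,\nu_n)$ be the optimal coupling and let $(f_n,g_n)$ be corresponding potentials. Suppose that $$\sup_{n\in\mathbb{N}}\int f_n^+\,d\mu_n<\infty,\qquad \sup_{n\in\mathbb{N}}\int g_n^+\,d\nu_n<\infty,$$ and that $\mu_n\to\mu$ and $\nu_n\to\nu$ in total variation, where $(\mu,\nu)\in\mathcal{P}(\mathcal{X})\times\mathcal{P}(\mathcal{Y})$ and $\mu\ll\mu_n$, $\nu\ll\nu_n$ for all $n$. Then ($\mathcal{C}(\mu,\nu)<\infty$ and) $\pi_n\to\pi_*$ in total variation, where $\pi_*\in\Pi(\mu,\nu)$ is the optimal coupling for $(\mu,\nu)$.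
   Context: $\mathcal{X},\mathcal{Y}$ are Polish spaces with their Borel $\sigma$-fields; $\mathcal{P}(\mathcal{X}),\mathcal{P}(\mathcal{Y})$ are the sets of Borel probability measures; $c:\mathcal{X}\times\mathcal{Y}\to[0,\infty)$ is continuous. $\Pi(\mu,\nu)$ is the set of couplings, i.e. probability measures on $\mathcal{X}\times\mathcal{Y}$ with marginals $(\mu,\nu)$. The entropic optimal transport problem is $$\mathcal{C}(\mu,\nu):=\inf_{\pi\in\Pi(\mu,\nu)}\int c\,d\pi+H(\pi|\mu\otimes\nu),$$ where $H(\pi|\rho)=\int\log\frac{d\pi}{d\rho}\,d\pi$ if $\pi\ll\rho$ and $H(\pi|\rho)=\infty$ otherwise. If $\mathcal{C}(\mu,\nu)<\infty$, there is a unique minimizer $\pi_*\in\Pi(\mu,\nu)$, called the optimal coupling, and there are measurable functions $f:\mathcal{X}\to\mathbb{R}$, $g:\mathcal{Y}\to\mathbb{R}$, called potentials for $(\mu,\nu)$, such that $\frac{d\pi_*}{d(\mu\otimes\nu)}=e^{f\oplus g-c}$ $\mu\otimes\nu$-a.s., where $(f\oplus g)(x,y):=f(x)+g(y)$. Potentials are a.s. unique up to an additive constant ($(f+a,g-a)$, $a\in\mathbb{R}$). $f^+=\max(f,0)$. *)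

(* Defs.v *)
From HB Require Import structures.
From mathcomp Require Import all_boot all_order all_algebra.
From mathcomp Require Import all_classical all_reals all_analysis.

Set Implicit Arguments.
Unset Strict Implicit.
Unset Printing Implicit Defensive.

Import Order.TTheory GRing.Theory Num.Theory.
Import numFieldNormedType.Exports.

Local Open Scope classical_set_scope.
Local Open Scope ring_scope.

(* [X] with its Borel sigma-algebra.  For second countable [X] and [Y], the
   product sigma-algebra carried by [(borel X * borel Y)%type] is the Borel
   sigma-algebra of the product topology. *)
Notation borel X := (g_sigma_algebraType (@open X)).

Definition separable (X : topologicalType) : Prop :=
  exists2 D : set X, countable D & dense D.

(* The metric is only required to exist: nothing below depends on it. *)
Definition completely_metrizable (R : realType) (X : topologicalType) : Prop :=
  exists d : X -> X -> R,
    [/\ [/\ forall x y, 0 <= d x y,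
            forall x y, d x y = 0 <-> x = y,
            forall x y, d x y = d y x
          & forall x y z, d x z <= d x y + d y z],
        forall (x : X) (U : set X),
          nbhs x U <-> exists2 e, 0 < e & [set y | d x y < e] `<=` U
      & forall u : nat -> X,
          (forall e, 0 < e -> exists N, forall m n,
             (N <= m)%N -> (N <= n)%N -> d (u m) (u n) < e) ->
          exists l : X, u @ \oo --> l].

Definition polish (R : realType) (X : topologicalType) : Prop :=
  separable X /\ completely_metrizable R X.

Local Open Scope ereal_scope.

(* Some authors use twice this distance; convergence is unaffected. *)
Definition tv_dist d (T : measurableType d) (R : realType)
    (P Q : probability T R) : \bar R :=
  ereal_sup [set `|P A - Q A| | A in [set A : set T | measurable A]].

Definition tv_cvg d (T : measurableType d) (R : realType)
    (P : nat -> probability T R) (Q : probability T R) : Prop :=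
  tv_dist (P n) Q @[n --> \oo] --> 0.

Definition density d (T : measurableType d) (R : realType)
    (P Q : probability T R) : T -> \bar R :=
  Radon_Nikodym (charge_of_finite_measure P) Q.

(* [lne] is the extended logarithm, [-oo] on nonpositive reals; the
   density is positive [P]-almost everywhere. *)
Definition rel_entropy d (T : measurableType d) (R : realType)
    (P Q : probability T R) : \bar R :=
  if `[< P `<< Q >]
  then \int[P]_x lne (density P Q x)
  else +oo.

Section entropic_optimal_transport.
Context d1 d2 (T1 : measurableType d1) (T2 : measurableType d2) (R : realType).
Variables (mu : probability T1 R) (nu : probability T2 R) (c : T1 * T2 -> R).
Implicit Type P : probability (T1 * T2)%type R.

Definition coupling P : Prop :=
  (forall A, measurable A -> P (fst @^-1` A) = mu A) /\
  (forall B, measurable B -> P (snd @^-1` B) = nu B).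

Definition eot_cost P : \bar R :=
  \int[P]_z (c z)%:E + rel_entropy P (mu \x nu).

Definition eot_value : \bar R :=
  ereal_inf [set eot_cost P | P in [set P | coupling P]].

Definition optimal_coupling P : Prop :=
  coupling P /\ eot_cost P = eot_value.

(* [P] is meant to be the optimal coupling.  The density equation forces
   [P `<< mu \x nu]: otherwise [Radon_Nikodym] is constantly [-oo]. *)
Definition potentials P (f : T1 -> R) (g : T2 -> R) : Prop :=
  [/\ measurable_fun setT f, measurable_fun setT g
    & {ae (mu \x nu), forall z,
        density P (mu \x nu) z = (expR (f z.1 + g z.2 - c z))%:E}].

End entropic_optimal_transport.

(* Main.v *)
Require Import Defs.
From HB Require Import structures.
From mathcomp Require Import all_boot all_order all_algebra.
From mathcomp Require Import all_classical all_reals all_analysis.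
From mathcomp Require Import measurable_realfun.
From mathcomp Require Import ring lra.

(** An optimal coupling is recognised by the shape of its density alone.
Suppose that a coupling [P] of [mu] and [nu] has density
[exp (F x + G y - c (x, y))] with respect to [mu \x nu], with [F] and [G]
integrable.  For every coupling [rho] of finite cost, the cost of [rho] is
[\int F dmu + \int G dnu] plus the relative entropy of [rho] with respect to
[P]; the latter is nonnegative and vanishes only if [rho = P].  Hence [P] is the
unique optimal coupling and its cost is finite ([eot_cost_potentials],
[eot_cost_ge_potentials]).  It is therefore enough to find, in every subsequence
of [pi_], a further subsequence that converges in total variation to a coupling
whose density has this shape ([optimal_subseq_limit]): all these limits then
coincide with the optimal coupling, and the whole sequence converges to it.

Since [c >= 0], the negative part of [f n + g n] is at most that of the logarithm
of the density of [pi_ n], whose integral under [pi_ n] is at most [1] because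
[t * ln t >= -1].  So the bounds on the positive parts of the potentials bound
them in [L1] ([potentials_L1]).

These [L1] bounds make the potentials converge almost everywhere along a
subsequence ([potential_ae_subseq]).  Indeed the first marginal condition reads
[exp (- f n x) = \int exp (g n - c (x, .)) dnu_n].  If the integral is restricted
to [|g n| <= L], the resulting functions [u n L] of [x] are bounded, and
equicontinuous because [nu_ n] converges in total variation; a diagonal
extraction on a countable dense set makes them converge at every point.  The
discarded part, divided by [exp (- f n x)], is the conditional probability of
[|g n| > L] given [x] under [pi_ n], and its mean is at most [K / L] by the Markov
inequality.  Hence the functions [1 / (1 + exp (- f n))] converge in [L1 mu], then
almost everywhere along a subsequence.  By the Fatou lemma the corresponding limit
of [f n] is finite almost everywhere.  The roles of the two spaces are symmetric,
which gives the convergence of [g].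

Finally the densities of [pi_ n] converge almost everywhere to the density [Z]
built from the limits of the potentials, and no mass escapes: [pi_ n] gives mass
at most [2 * K / L] to the points where [|f n| > L] or [|g n| > L], and elsewhere
its density is at most [exp (2 * L)].  This bounds [pi_ n A] by
[\int_A Z] plus an error that is uniform in [A]; as the integral of [Z] is at most
[1] by the Fatou lemma, the convergence is in total variation ([tv_limit]). *)

Set Implicit Arguments.
Unset Strict Implicit.
Unset Printing Implicit Defensive.

Import Order.TTheory GRing.Theory Num.Theory.
Import numFieldNormedType.Exports.

Local Open Scope classical_set_scope.
Local Open Scope ring_scope.

(** * Probabilities given by a density *)

Lemma integral_cst_probability d (T : measurableType d) (R : realType)
  (P : probability T R) (r : R) : (\int[P]_x r%:E = r%:E)%E.
Proof.
rewrite integral_cst//= [X in (_ * X)%E](_ : _ = 1%E) ?mule1//.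
exact: probability_setT.
Qed.

Section density.
Context d (T : measurableType d) (R : realType).
Implicit Types (P Q : probability T R) (h : T -> R).
Local Open Scope ereal_scope.

(** Replaces [density P Q], which is determined only almost everywhere, by a function
that can be chosen real-valued and nonnegative everywhere. *)
Definition has_density P Q h : Prop :=
  forall A, measurable A -> P A = \int[Q]_(x in A) (h x)%:E.

Context (P Q : probability T R) (h : T -> R).
Hypotheses (mh : measurable_fun setT h) (h0 : forall x, (0 <= h x)%R).

Lemma has_density_dominates : has_density P Q h -> P `<< Q.
Proof.
move=> hPQ; apply/null_content_dominatesP => A mA QA0; rewrite hPQ//.
apply/eqP; rewrite eq_le integral_ge0 ?andbT; last by move=> x _; rewrite lee_fin.
have := @integral_abs_eq0 _ _ _ Q A (EFin \o h) mA.
move=> /(_ _ QA0) <-; last by apply/measurable_EFinP; exact: measurable_funTS.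
apply: ge0_le_integral => //= [x _|||x _]; rewrite ?lee_fin ?ler_norm//.
- by apply/measurable_EFinP; exact: measurable_funTS.
- by apply/measurable_EFinP; apply: measurable_funTS; exact: measurableT_comp.
Qed.

Lemma has_density_ae : has_density P Q h ->
  {ae Q, forall x, density P Q x = (h x)%:E}.
Proof.
move=> hPQ; have PQ := has_density_dominates hPQ.
have PQ' : charge_of_finite_measure P `<< Q by exact: PQ.
have := @integral_ae_eq _ _ _ Q setT measurableT (EFin \o h) (density P Q).
move=> /(_ (Radon_Nikodym_integrable PQ')).
move=> /(_ _ _)[|E _ mE|N [mN N0 sN]].
- exact/measurable_EFinP.
- by rewrite -Radon_Nikodym_integral//=; exact: hPQ.
- by exists N; split => // x /= H; apply: sN => /= H2; apply: H; exact: H2.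
Qed.

(** If [P] were not dominated by [Q], then [Radon_Nikodym] would be constantly
[-oo], which is never equal to a real number on a set of full measure. *)
Lemma ae_has_density : {ae Q, forall x, density P Q x = (h x)%:E} ->
  has_density P Q h.
Proof.
move=> aeh A mA.
have PQ : charge_of_finite_measure P `<< Q.
  apply: contrapT => nPQ; move: aeh; rewrite /density /Radon_Nikodym.
  case: pselect => // _ [N [mN N0 sN]].
  have : Q setT <= Q N.
    by apply: le_measure; rewrite ?inE// => x _; apply: sN.
  by rewrite N0 probability_setT leNgt lte01.
transitivity (\int[Q]_(x in A) density P Q x).
  exact: (@Radon_Nikodym_integral _ _ _ (charge_of_finite_measure P)).
apply: ae_eq_integral => //.
- apply: (measurable_funS measurableT) => //.
  exact: measurable_int (Radon_Nikodym_integrable PQ).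
- by apply/measurable_EFinP; exact: measurable_funTS.
- by apply: filterS aeh => x + _.
Qed.

Lemma integral_has_density (k : T -> \bar R) : has_density P Q h ->
  measurable_fun setT k -> (forall x, 0 <= k x) ->
  \int[P]_x k x = \int[Q]_x (k x * (h x)%:E).
Proof.
move=> hPQ mk k0; have PQ := has_density_dominates hPQ.
have mRN : measurable_fun setT (Radon_Nikodym_SigmaFinite.f P Q).
  exact: measurable_int (Radon_Nikodym_SigmaFinite.f_integrable PQ).
rewrite -(Radon_Nikodym_SigmaFinite.change_of_variables PQ)//.
apply: ae_eq_integral => //.
- exact: emeasurable_funM.
- by apply: emeasurable_funM => //; exact/measurable_EFinP.
- have H1 := has_density_ae hPQ.
  have H2 := ae_eq_Radon_Nikodym_SigmaFinite PQ measurableT.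
  by apply: filterS2 H1 H2 => x + /(_ I) -> _; rewrite /density => ->.
Qed.

End density.

Lemma dominates_has_density d (T : measurableType d) (R : realType)
    (P Q : probability T R) : P `<< Q ->
  exists h : T -> R, [/\ measurable_fun setT h, forall x, 0 <= h x & has_density P Q h].
Proof.
move=> PQ; pose RN := Radon_Nikodym_SigmaFinite.f P Q.
have RN0 x : (0 <= RN x)%E by exact: Radon_Nikodym_SigmaFinite.f_ge0.
exists (fine \o RN); split => [|x|A mA].
- apply: measurableT_comp => //.
  exact: measurable_int (Radon_Nikodym_SigmaFinite.f_integrable PQ).
- exact: fine_ge0.
- rewrite (Radon_Nikodym_SigmaFinite.f_integral PQ mA).
  apply: eq_integral => x _ /=; rewrite fineK//.
  exact: Radon_Nikodym_SigmaFinite.f_fin_num.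
Qed.

Section density_probability.
Context d (T : measurableType d) (R : realType) (Q : probability T R).
Context (h : T -> R).
Hypotheses (mh : measurable_fun setT h) (h0 : forall x, (0 <= h x)%R).
Local Open Scope ereal_scope.

Let nuh (A : set T) : \bar R := \int[Q]_(x in A) (h x)%:E.

Let nuh_sigma_additive : semi_sigma_additive nuh.
Proof.
move=> A mA tA mUA; rewrite /nuh ge0_integral_bigcup//=.
- apply: is_cvg_ereal_nneg_natsum_cond => n _ _.
  by apply: integral_ge0 => x _; rewrite lee_fin.
- by apply/measurable_EFinP; exact: measurable_funTS.
- by move=> x _; rewrite lee_fin.
Qed.

Lemma probability_of_density : \int[Q]_x (h x)%:E = 1 ->
  exists P : probability T R, has_density P Q h.
Proof.
move=> h1.
have nuh0 : nuh set0 = 0 by rewrite /nuh integral_set0.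
have nuh_ge0 A : 0 <= nuh A by apply: integral_ge0 => x _; rewrite lee_fin.
pose M := isMeasure.Build _ _ _ nuh nuh0 nuh_ge0 nuh_sigma_additive.
pose mM : {measure set T -> \bar R} := HB.pack nuh M.
have mM1 : mM setT = 1 by [].
pose N := Measure_isProbability.Build _ _ R mM mM1.
pose P : probability T R := HB.pack (mM : set T -> \bar R) M N.
by exists P.
Qed.

End density_probability.

(** * Total variation *)

Section total_variation.
Context d (T : measurableType d) (R : realType).
Implicit Types P Q : probability T R.
Local Open Scope ereal_scope.

(** A one-sided bound is enough: taking complements gives the other side, see
[tv_close_sym]. *)
Definition tv_close (e : R) P Q : Prop :=
  forall A, measurable A -> P A <= Q A + e%:E.

Lemma tv_close_sym e P Q : tv_close e P Q -> tv_close e Q P.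
Proof.
move=> PQ A mA; have := PQ _ (measurableC mA).
rewrite !probability_setC//.
rewrite -(fineK (fin_num_measure P A mA)) -(fineK (fin_num_measure Q A mA)).
rewrite -!EFinB -!EFinD !lee_fin; lra.
Qed.

Lemma tv_close_ge0 e P Q : tv_close e P Q -> (0 <= e)%R.
Proof.
move=> /(_ _ measurableT); rewrite !probability_setT -EFinD lee_fin; lra.
Qed.

Lemma tv_dist_ge0 P Q : 0 <= tv_dist P Q.
Proof.
apply: (@le_trans _ _ `|P set0 - Q set0|) => //.
by apply: ereal_sup_ubound; exists set0 => //=; exact: measurable0.
Qed.

Lemma tv_dist_le e P Q : tv_close e P Q -> tv_dist P Q <= e%:E.
Proof.
move=> PQ; apply: ge_ereal_sup => _ [A mA <-] /=.
have := PQ A mA; have := tv_close_sym PQ mA.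
rewrite -(fineK (fin_num_measure P A mA)) -(fineK (fin_num_measure Q A mA)).
rewrite -!EFinD !lee_fin ler_norml; lra.
Qed.

Lemma tv_dist_close P Q : tv_dist P Q \is a fin_num /\ tv_close (fine (tv_dist P Q)) P Q.
Proof.
have fin : tv_dist P Q \is a fin_num.
  rewrite ge0_fin_numE ?tv_dist_ge0//.
    apply: (@le_lt_trans _ _ 1%:E); last exact: ltry.
    apply: tv_dist_le => A mA.
    have := probability_le1 P mA; have : 0 <= Q A by [].
    rewrite -(fineK (fin_num_measure P A mA)) -(fineK (fin_num_measure Q A mA)).
    rewrite -!EFinD !lee_fin; lra.
split => // A mA; rewrite fineK//.
have : `|P A - Q A| <= tv_dist P Q.
  by apply: ereal_sup_ubound; exists A.
rewrite -(fineK (fin_num_measure P A mA)) -(fineK (fin_num_measure Q A mA)) -(fineK fin).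
by rewrite -!EFinD !lee_fin ler_norml; lra.
Qed.

Lemma tv_cvgP (P_ : nat -> probability T R) Q :
  tv_cvg P_ Q <-> exists e : nat -> R,
    e n @[n --> \oo] --> (0%R : R) /\ forall n, tv_close (e n) (P_ n) Q.
Proof.
split=> [PQ|[e [e0 PQ]]].
  exists (fun n => fine (tv_dist (P_ n) Q)); split; last first.
    by move=> n; have [] := tv_dist_close (P_ n) Q.
  by apply: fine_cvg; exact: PQ.
apply: (@squeeze_cvge _ _ _ _ (cst 0) _ (fun n => (e n)%:E)).
- by apply: nearW => n; rewrite tv_dist_le// tv_dist_ge0.
- exact: cvg_cst.
- by apply: cvg_EFin => //; exact: nearW.
Qed.

Lemma tv_cvg_set (P_ : nat -> probability T R) P A :
  tv_cvg P_ P -> measurable A -> P_ n A @[n --> \oo] --> P A.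
Proof.
move=> /tv_cvgP[e [e0 PP]] mA.
rewrite -(fineK (fin_num_measure P A mA)); apply: cvg_EFin.
  by apply: nearW => n; exact: fin_num_measure.
apply/cvgrPdist_le => eps eps0; have /cvgrPdist_le/(_ _ eps0) := e0.
apply: filterS => n; rewrite sub0r normrN => /(le_trans (ler_norm _)) en.
have [h1 h2] : (fine (P_ n A) <= fine (P A) + e n /\
    fine (P A) <= fine (P_ n A) + e n)%R.
  split; rewrite -lee_fin EFinD !fineK ?fin_num_measure//; first exact: PP.
  exact: (tv_close_sym (PP n)).
by rewrite /= ler_norml; lra.
Qed.

(** The two integrals are the integrals over [t] in [0, M] of the measures of
[h > t], and those differ by at most [e]. *)
Lemma tv_close_integral e P Q (h : T -> R) (M : R) : tv_close e P Q ->
  measurable_fun setT h -> (forall x, (0 <= h x <= M)%R) ->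
  \int[P]_x (h x)%:E <= \int[Q]_x (h x)%:E + (M * e)%:E.
Proof.
move=> PQ mh hM; have e0 := tv_close_ge0 PQ.
have M0 : (0 <= M)%R by have /andP[/le_trans/[apply]] := hM point.
have mhr r : measurable (h @^-1` `]r, +oo[).
  by rewrite -[X in measurable X]setTI; exact: mh.
pose hm := isMeasurableFun.Build _ _ _ _ h mh.
pose H : {mfun T >-> R} := HB.pack h hm.
pose X : {RV P >-> R} := H.
pose Y : {RV Q >-> R} := H.
have H0 x : (0 <= H x)%R by have /andP[] := hM x.
have := @ge0_expectation_ccdf _ _ _ P X H0.
have := @ge0_expectation_ccdf _ _ _ Q Y H0.
rewrite !expectation_def => -> ->.
have -> : (M * e)%:E =
    \int[lebesgue_measure]_(r in `[0%R, +oo[) (e%:E * (\1_(`[0%R, M]) r)%:E).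
  rewrite ge0_integralZl//; last first.
    by apply/measurable_EFinP; exact: measurable_indic.
  rewrite integral_indic// setIidl; last first.
    by move=> x /=; rewrite !in_itv/= => /andP[->].
  have -> : e%:E * lebesgue_measure `[0%R, M]%classic = (M * e)%:E; last by [].
  rewrite lebesgue_measure_itv/= lte_fin; case: ltrP => [_|M0'].
    by rewrite oppr0 adde0 -EFinM mulrC.
  by have -> : M = 0%R; [lra|rewrite mul0r mule0].
rewrite -ge0_integralD//=; first last.
- by apply: emeasurable_funM => //; apply/measurable_EFinP; exact: measurable_indic.
- by move=> x _; rewrite mule_ge0.
- by apply: measurable_funTS; exact: ccdf_measurable.
apply: ge0_le_integral => //=.
- by apply: measurable_funTS; exact: ccdf_measurable.
- apply: emeasurable_funD; first by apply: measurable_funTS; exact: ccdf_measurable.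
  by apply: emeasurable_funM => //; apply/measurable_EFinP; exact: measurable_indic.
move=> r; rewrite in_itv/= andbT => r0; rewrite /ccdf /distribution /pushforward/=.
(* the level sets above [M] are empty *)
rewrite indicE; have [rM|] := boolP (r \in `[0%R, M]%classic).
  by rewrite mule1; exact: PQ.
move=> /negP; rewrite inE /= in_itv/= r0/= => /negP; rewrite -ltNge => Mr.
rewrite mule0 adde0 (_ : h @^-1` `]r, +oo[ = set0) ?measure0//.
apply/seteqP; split => // x /=; rewrite in_itv/= andbT => rx.
by have /andP[_] := hM x; lra.
Qed.

End total_variation.

Section tv_product.
Context d1 d2 (T1 : measurableType d1) (T2 : measurableType d2) (R : realType).
Local Open Scope ereal_scope.

(** Replace [nu1] by [nu2] in each section of the set, then [mu1] by [mu2] under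
the integral of the measures of the sections. *)
Lemma tv_close_prod (a b : R) (mu1 mu2 : probability T1 R)
    (nu1 nu2 : probability T2 R) :
  tv_close a mu1 mu2 -> tv_close b nu1 nu2 ->
  tv_close (a + b) (mu1 \x nu1) (mu2 \x nu2).
Proof.
move=> mu12 nu12 A mA.
have b0 := tv_close_ge0 nu12.
have mx (nu : probability T2 R) : measurable_fun setT (nu \o xsection A).
  exact: measurable_fun_xsection.
rewrite /= /product_measure1.
apply: (@le_trans _ _ (\int[mu1]_x ((nu2 \o xsection A) x + b%:E))).
  apply: ge0_le_integral => //=.
  - by apply: emeasurable_funD => //; exact: mx.
  - by move=> x _; apply: nu12; exact: measurable_xsection.
rewrite ge0_integralD//=.
rewrite integral_cst_probability EFinD addeA leeD2r//.
have fin x : nu2 (xsection A x) \is a fin_num.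
  by apply: fin_num_measure; exact: measurable_xsection.
have := @tv_close_integral _ _ _ _ _ _ (fine \o nu2 \o xsection A) 1%R mu12.
rewrite mul1r; under eq_integral do rewrite /= fineK//.
under [X in _ <= X + _]eq_integral do rewrite /= fineK//.
apply; first by apply: measurableT_comp => //; exact: mx.
move=> x; rewrite -!lee_fin /= fineK// measure_ge0/=.
by apply: probability_le1; exact: measurable_xsection.
Qed.

End tv_product.

(** * Measurability of the cost and dense sequences *)

Lemma measurable_potentials d1 d2 (T1 : measurableType d1) (T2 : measurableType d2)
    (R : realType) (f : T1 -> R) (g : T2 -> R) (c : T1 * T2 -> R) :
  measurable_fun setT f -> measurable_fun setT g -> measurable_fun setT c ->
  measurable_fun setT (fun z => expR (f z.1 + g z.2 - c z)).
Proof.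
move=> mf mg mc; apply: (measurableT_comp (@measurable_expR R)).
apply: measurable_funB => //.
by apply: measurable_funD; exact: measurableT_comp.
Qed.

Section polish_space.
Context (R : realType).

Lemma polish_dense_seq (X : ptopologicalType) : polish R X ->
  exists (d : X -> X -> R) (D : nat -> X),
  [/\ forall x y z, d x z <= d x y + d y z,
      forall x y, d x y = d y x,
      forall (x : X) (U : set X),
        nbhs x U <-> exists2 e, 0 < e & [set y | d x y < e] `<=` U
    & forall x e, 0 < e -> exists i, d x (D i) < e].
Proof.
move=> [[A cA dA] [d [[d0 deq dsym dtri] dnbhs _]]].
have A0 : A !=set0.
  have [x [_ Ax]] : setT `&` A !=set0; last by exists x.
  by apply: dA; [exists point|exact: openT].
have [A00|[D]] := pfcard_geP cA; first by move: A0; rewrite A00 => -[].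
exists d, D; split => // x e e0.
have op : open [set y | d x y < e].
  rewrite openE => y /= xy; rewrite /interior; apply/dnbhs.
  exists (e - d x y); first by rewrite subr_gt0.
  by move=> z /= yz; apply: le_lt_trans (dtri x y z) _; lra.
have [y [/= xy Ay]] : [set y | d x y < e] `&` A !=set0.
  by apply: dA op; exists x => /=; have /deq -> := erefl x.
have [n _ ny] := 'surj_D Ay.
by exists n; rewrite ny.
Qed.

(** The form in which separability is used: it mentions neither the metric nor
open sets, so that the compactness argument below needs no topology. *)
Lemma polish_dense_cvg (X : ptopologicalType) : polish R X ->
  exists D : nat -> X, forall x : X, exists s : nat -> nat, D (s n) @[n --> \oo] --> x.
Proof.
move=> /polish_dense_seq[d [D [_ _ dnbhs dD]]]; exists D => x.
have /choice[s sD] : forall n : nat, exists i, d x (D i) < n.+1%:R^-1.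
  by move=> n; apply: dD; rewrite invr_gt0.
exists s => U /dnbhs[e e0 eU].
have ne := near_infty_natSinv_lt (PosNum e0).
by apply: filterS ne => n ne; apply: eU => /=; exact: lt_trans (sD n) ne.
Qed.

Lemma polish_basis (X : ptopologicalType) : polish R X ->
  exists U : nat * nat -> set X, (forall i, open (U i)) /\
  forall (x : X) V, nbhs x V -> exists2 i, U i x & U i `<=` V.
Proof.
move=> /polish_dense_seq[d [D [dtri dsym dnbhs dD]]].
exists (fun i => [set y | d (D i.1) y < i.2.+1%:R^-1]); split.
  move=> [i k] /=; rewrite openE => y /= xy; rewrite /interior; apply/dnbhs.
  exists (k.+1%:R^-1 - d (D i) y); first by rewrite subr_gt0.
  by move=> z /= yz; apply: le_lt_trans (dtri (D i) y z) _; rewrite -ltrBrDl.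
move=> x V /dnbhs[e e0 eV].
have [k ke] : exists k : nat, k.+1%:R^-1 < e / 2.
  have e20 : 0 < e / 2 by rewrite divr_gt0.
  have [k _ /(_ k (leqnn k))] := near_infty_natSinv_lt (PosNum e20).
  by exists k.
have [|i xi] := dD x k.+1%:R^-1; first by rewrite invr_gt0.
exists (i, k) => /=; first by rewrite dsym.
move=> y /= iy; apply: eV => /=.
apply: le_lt_trans (dtri _ (D i) y) _.
  by rewrite (splitr e); apply: ltrD; [exact: lt_trans xi ke|exact: lt_trans iy ke].
Qed.

(** A continuous function is a priori measurable for the Borel sets of the product
topology only.  With countable bases an open set of the product is a countable
union of open rectangles, hence lies in the product sigma-algebra. *)
Lemma continuous_measurable_prod (X Y : ptopologicalType) (c : (X * Y)%type -> R) :
  polish R X -> polish R Y -> continuous c ->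
  measurable_fun setT (c : borel X * borel Y -> R).
Proof.
move=> /polish_basis[U [oU bU]] /polish_basis[V [oV bV]] cc.
apply: (measurability (@RGenOInfty.G R)); first exact: RGenOInfty.measurableE.
move=> _ [_ [a ->] <-]; rewrite setTI.
pose S := [set ij : (nat * nat) * (nat * nat) |
  U ij.1 `*` V ij.2 `<=` c @^-1` `]a, +oo[].
have -> : c @^-1` `]a, +oo[ = \bigcup_(ij in S) (U ij.1 `*` V ij.2).
  apply/seteqP; split => [[x y] /= cxy|xy [ij]]; last first.
    by move=> Sij Hij; exact: Sij Hij.
  have : nbhs (x, y) (c @^-1` `]a, +oo[).
    apply: cc; apply: open_nbhs_nbhs; split; last exact: cxy.
    exact: interval_open.
  move=> [[A B] /= [/bU[i Uix UiA] /bV[j Vjy VjB]] AB].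
  exists (i, j) => // -[x' y'] [/= Ux Vy]; apply: AB; split => /=;
    [exact: UiA|exact: VjB].
rewrite bigcup_mkcond; apply: countable_bigcupT_measurable => [|[i j] /=]; first exact: countableP.
case: ifP => _; last exact: measurable0.
by apply: measurableX; apply: sub_sigma_algebra; [exact: oU|exact: oV].
Qed.

End polish_space.

(** * Sequences and subsequences *)

Lemma cvge0_near_lt (R : realType) (a : nat -> \bar R) (eps : R) :
  a n @[n --> \oo] --> (0 : \bar R)%E -> 0 < eps ->
  \forall n \near \oo, (a n < eps%:E)%E.
Proof.
move=> a0 eps0.
have /a0 : nbhs (0 : \bar R)%E [set y | (y < eps%:E)%E].
  by apply: open_nbhs_nbhs; split; [exact: open_ereal_lt_ereal|rewrite /= lte_fin].
by [].
Qed.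

Lemma cvg0_near_le (R : realType) (e : nat -> R) (eps : R) :
  e n @[n --> \oo] --> (0 : R) -> 0 < eps -> \forall n \near \oo, e n <= eps.
Proof.
move=> e0 eps0; have /cvgrPdist_le/(_ _ eps0) := e0; apply: filterS => n.
by rewrite sub0r normrN; apply: le_trans; exact: ler_norm.
Qed.

Lemma cvge0_small (R : realType) (a : nat -> \bar R) :
  (forall n, 0 <= a n)%E ->
  (forall eps : R, 0 < eps -> \forall n \near \oo, (a n <= eps%:E)%E) ->
  a n @[n --> \oo] --> (0 : \bar R)%E.
Proof.
move=> a0 ae.
have fin : \forall n \near \oo, a n \is a fin_num.
  apply: filterS (ae 1 ltr01) => n an.
  by rewrite ge0_fin_numE//; apply: le_lt_trans an (ltry _).
apply: cvg_EFin => //; apply/cvgrPdist_le => eps eps0.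
apply: filterS2 fin (ae eps eps0) => n fn an.
by rewrite sub0r normrN /= ger0_norm ?fine_ge0// -lee_fin fineK.
Qed.

(** Subsequences are indexed by maps [phi] such that [k <= phi k], which need not
be increasing: this is all that passing to the limit requires. *)
Lemma cvg_subseq (T : topologicalType) (u : nat -> T) (l : T) (phi : nat -> nat) :
  (forall k, (k <= phi k)%N) -> u n @[n --> \oo] --> l -> u (phi k) @[k --> \oo] --> l.
Proof.
move=> kphi ul; apply: (cvg_comp _ _ _ ul) => A [N _ NA].
by exists N => // k /= Nk; apply: NA; exact: leq_trans Nk (kphi k).
Qed.

Lemma filter_forall_lt (G : set_system nat) (FG : Filter G)
    (P : nat -> nat -> Prop) (m : nat) :
  (forall i, G [set n | P i n]) -> G [set n | forall i, (i < m)%N -> P i n].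
Proof.
move=> GP; elim: m => [|m IH]; first by apply: filterS filterT.
apply: filterS2 IH (GP m) => n IH Pm i; rewrite ltnS leq_eqVlt => /orP[/eqP->//|].
exact: IH.
Qed.

(** The usual diagonal extraction is replaced by an ultrafilter on the indices:
every bounded sequence converges along it, so that all the limits are chosen at
once, and the sets of indices which are good for finitely many sequences belong to
the ultrafilter, hence are nonempty. *)
Lemma diagonal_subsequence (R : realType) (a : nat -> nat -> R) (B : nat -> R) :
  (forall i n, `|a i n| <= B i) ->
  exists phi : nat -> nat, (forall k, (k <= phi k)%N) /\
    forall i, cvgn (fun k => a i (phi k)).
Proof.
move=> aB; have [G [UG ooG]] := @ultraFilterLemma nat \oo _.
have /choice[p pP] : forall i, exists p : R, a i n @[n --> G] --> p.
  move=> i; have /(_ (a i n @[n --> G]) _)[|p [_ clp]] := @segment_compact R (- B i) (B i).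
    change (G (a i @^-1` `[- B i, B i])).
    by apply: filterS filterT => n _ /=; rewrite in_itv/= -ler_norml.
  exists p => V pV; have [//|GnV] := in_ultra_setVsetC (a i @^-1` V) UG.
  have [x [/= nVx Vx]] := clp (~` V) V GnV pV.
  by [].
have /choice[phi phiP] : forall k, exists n, (k <= n)%N /\
    forall i, (i < k)%N -> `|p i - a i n| < k.+1%:R^-1.
  move=> k.
  have G1 : G [set n | (k <= n)%N] by apply: ooG; exact: nbhs_infty_ge.
  have G2 : G [set n | forall i, (i < k)%N -> `|p i - a i n| < k.+1%:R^-1].
    apply: filter_forall_lt => i.
    have := pP i; move/cvgr_dist_lt; apply.
    by rewrite invr_gt0.
  by have [n [Hn1 Hn2]] := filter_ex (filterI G1 G2); exists n.
exists phi; split=> [k|i]; first by have [] := phiP k.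
apply/cvg_ex; exists (p i); apply/cvgrPdist_lt => e e0.
near=> k; have [_ /(_ i)] := phiP k.
have ik : (i < k)%N by near: k; exact: nbhs_infty_gt.
move=> /(_ ik) /lt_trans; apply.
by near: k; exact: near_infty_natSinv_lt (PosNum e0).
Unshelve. all: by end_near. Qed.

Section ae_subsequence.
Context d (T : measurableType d) (R : realType) (P : probability T R).
Local Open Scope ereal_scope.

(** Choose the subsequence so that its integrals are summable; then the series of
the functions is almost everywhere finite, and its terms tend to [0]. *)
Lemma integral_cvg0_ae_subseq (h : nat -> T -> R) :
  (forall n, measurable_fun setT (h n)) -> (forall n x, (0 <= h n x)%R) ->
  \int[P]_x (h n x)%:E @[n --> \oo] --> 0 ->
  exists phi : nat -> nat, (forall k, (k <= phi k)%N) /\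
    {ae P, forall x, h (phi k) x @[k --> \oo] --> (0 : R)%R}.
Proof.
move=> mh h0 ih.
have /choice[phi phiP] : forall k, exists n, (k <= n)%N /\
    \int[P]_x (h n x)%:E <= (1 / (2 ^ k.+1)%:R)%:E.
  move=> k.
  have e0 : (0 < 1 / (2 ^ k.+1)%:R :> R)%R by rewrite divr_gt0// ltr0n expn_gt0.
  have [N1 _ N1P] := nbhs_infty_ge k.
  have [N2 _ N2P] := cvge0_near_lt ih e0.
  exists (maxn N1 N2); split; first by apply: N1P; exact: leq_maxl.
  by apply/ltW/N2P; exact: leq_maxr.
exists phi; split=> [k|]; first by have [] := phiP k.
have mphi n : measurable_fun setT (EFin \o h (phi n)) by exact/measurable_EFinP.
have si : P.-integrable setT (fun x => \sum_(k <oo) (h (phi k) x)%:E).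
  apply/integrableP; split.
    apply: ge0_emeasurable_sum; last by move=> n _; exact: mphi.
    by move=> n x _ _; rewrite lee_fin.
  under eq_integral => x _.
    rewrite gee0_abs; last by apply: nneseries_ge0 => n _ _; rewrite lee_fin.
    over.
  rewrite integral_nneseries //; last by move=> n x _; rewrite lee_fin.
  apply: (@le_lt_trans _ _ (\sum_(k <oo) (1 / (2 ^ k.+1)%:R)%:E)).
    apply: lee_nneseries => k _; last by have [] := phiP k.
    by move=> _; apply: integral_ge0 => x _; rewrite lee_fin.
  by apply: le_lt_trans (epsilon_trick0 _ _) _ => //; rewrite ltry.
have := integrable_ae measurableT si; apply: filterS => x /(_ I) xfin.
have tail0 : \sum_(N <= k <oo) (h (phi k) x)%:E @[N --> \oo] --> 0.
  by apply: nneseries_tail_cvg; rewrite ?ltey_eq ?xfin// => k _; rewrite lee_fin.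
apply: (@fine_cvg _ _ _ _ (fun k => (h (phi k) x)%:E)).
apply: (@squeeze_cvge _ _ _ _ (cst 0) _ _ _ _ _ tail0); last exact: cvg_cst.
apply: nearW => N; rewrite lee_fin h0/=.
have := @nneseries_lim_ge R (fun k => (h (phi k) x)%:E) xpredT N N.+1.
by rewrite big_nat1; apply=> n _ _; rewrite lee_fin.
Qed.

End ae_subsequence.

(** * The Fatou lemma with varying measures *)

Section fatou_total_variation.
Context d (T : measurableType d) (R : realType).
Context (P_ : nat -> probability T R) (P : probability T R) (e : nat -> R).
Hypothesis (e0 : e n @[n --> \oo] --> (0 : R)).
Hypothesis (P_P : forall n, tv_close (e n) (P_ n) P).
Local Open Scope ereal_scope.

(** Total variation controls the integrals of bounded functions only, hence the
lower envelopes [inf_(m >= N) h m] are truncated at level [N] before the measures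
are exchanged; the truncated envelopes increase to the lower limit of [h]. *)
Lemma tv_fatou (h : nat -> T -> R) (K : R) :
  (forall n, measurable_fun setT (h n)) -> (forall n x, (0 <= h n x)%R) ->
  (forall n, \int[P_ n]_x (h n x)%:E <= K%:E) ->
  \int[P]_x limn_einf (fun n => (h n x)%:E) <= K%:E.
Proof.
move=> mh h0 hK.
pose I N x := einfs (fun n => (h n x)%:E) N.
pose J N x := mine (I N x) N%:R%:E.
have Eh n : measurable_fun setT (fun x => (h n x)%:E) by exact/measurable_EFinP.
have mI N : measurable_fun setT (I N) by exact: measurable_fun_einfs.
have mJ N : measurable_fun setT (J N) by exact: measurable_mine.
have I0 N x : 0 <= I N x.
  by apply: le_ereal_inf_tmp => _ [m /= _ <-]; rewrite lee_fin.
have J0 N x : 0 <= J N x by rewrite le_min I0 lee_fin ler0n.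
have Ih N n x : (N <= n)%N -> I N x <= (h n x)%:E.
  by move=> Nn; apply: ereal_inf_lbound; exists n.
have ndJ x : {homo J ^~ x : n m / (n <= m)%N >-> n <= m}.
  move=> n m nm; rewrite /J le_min ge_min nondecreasing_einfs//=.
  by rewrite ge_min !lee_fin ler_nat nm orbT.
have JK N : \int[P]_x J N x <= K%:E.
  apply/lee_addgt0Pr => eps eps0.
  have [n Nn ne] : exists2 n, (N <= n)%N & (N%:R * e n <= eps)%R.
    have Ne0 : (N%:R * e n)%R @[n --> \oo] --> (0 : R)%R.
      by rewrite -(mulr0 N%:R); apply: cvgM => //; exact: cvg_cst.
    have [n1 _ n1P] := cvg0_near_le Ne0 eps0.
    by exists (maxn n1 N); [exact: leq_maxr|exact: (n1P _ (leq_maxl _ _))].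
  have mm : measurable_fun setT (fun x => Num.min (h n x) N%:R).
    exact: measurable_minr.
  have m0 x : (0 <= Num.min (h n x) N%:R)%R by rewrite le_min h0 ler0n.
  apply: (@le_trans _ _ (\int[P]_x (Num.min (h n x) N%:R)%:E)).
    apply: ge0_le_integral => //; first exact/measurable_EFinP.
    move=> x _; rewrite /J EFin_min le_min !ge_min lexx orbT andbT.
    by rewrite Ih.
  apply: (le_trans (tv_close_integral (tv_close_sym (P_P n)) mm (M := N%:R) _)).
    by move=> x; rewrite m0/= ge_min lexx orbT.
  apply: leeD; last by rewrite lee_fin.
  apply: le_trans (hK n); apply: ge0_le_integral => //.
  - by move=> x _; rewrite lee_fin.
  - exact/measurable_EFinP.
  - by move=> x _; rewrite lee_fin ge_min lexx.
apply: (@le_trans _ _ (\int[P]_x limn (J ^~ x))).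
  apply: ge0_le_integral => //.
  - move=> x _; rewrite limn_einf_lim; apply: lime_ge; first exact: is_cvg_einfs.
    by apply: nearW => n; exact: I0.
  - under eq_fun do rewrite limn_einf_lim.
    by apply: emeasurable_fun_cvg => // x _; exact: is_cvg_einfs.
  - apply: (emeasurable_fun_cvg J) => // x _; apply: ereal_nondecreasing_is_cvgn.
    exact: ndJ.
  - move=> x _; rewrite limn_einf_lim; apply: lime_le; first exact: is_cvg_einfs.
    apply: nearW => N; rewrite (cvg_lim _ (ereal_nondecreasing_cvgn (ndJ x)))//.
    have IN : I N x \is a fin_num.
      by rewrite ge0_fin_numE ?I0//; apply: le_lt_trans (Ih N N x _) _; rewrite ?ltry.
    pose M := maxn N (Num.truncn (fine (I N x))).+1.
    apply: (@le_trans _ _ (J M x)); last by apply: ereal_sup_ubound; exists M.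
    rewrite /J le_min nondecreasing_einfs ?leq_maxl//=.
    rewrite -[leLHS]fineK// lee_fin (le_trans (ltW (truncnS_gt _)))//.
    by rewrite ler_nat leq_maxr.
have cJ : \int[P]_x J n x @[n --> \oo] --> \int[P]_x limn (J ^~ x).
  by apply: cvg_monotone_convergence => // x _; exact: ndJ.
rewrite -(cvg_lim _ cJ)//; apply: lime_le; first by apply/cvg_ex; eexists; exact: cJ.
exact: nearW.
Qed.

End fatou_total_variation.

(** * Pointwise limits, bounded convergence and the logistic function *)

Lemma cvg_of_approx (R : realType) (a : nat -> R) :
  (forall eps : R, 0 < eps -> exists b : nat -> R, cvgn b /\
    \forall k \near \oo, `|a k - b k| <= eps) -> cvgn a.
Proof.
move=> ab; apply: cauchy_cvg; apply: cauchy_exP => eps eps0.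
have [b [/cvg_ex[l bl] abn]] := ab (eps / 2) (divr_gt0 eps0 (ltr0Sn _ 1)).
exists l; change (\forall k \near \oo, ball l eps (a k)).
have /cvgrPdist_lt/(_ _ (divr_gt0 eps0 (ltr0Sn _ 1))) bn := bl.
apply: filterS2 abn bn => k ab1 bl1; rewrite -ball_normE/= (splitr eps).
have -> : l - a k = (l - b k) - (a k - b k) by ring.
by apply: le_lt_trans (ler_normB _ _) _; exact: ltr_leD.
Qed.

Section bounded_convergence.
Context d (T : measurableType d) (R : realType) (P : probability T R).
Local Open Scope ereal_scope.

Lemma bounded_cvg0 (h : nat -> T -> R) (M : R) :
  (forall n, measurable_fun setT (h n)) -> (forall n x, (0 <= h n x <= M)%R) ->
  {ae P, forall x, h n x @[n --> \oo] --> (0 : R)%R} ->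
  \int[P]_x (h n x)%:E @[n --> \oo] --> 0.
Proof.
move=> mh hM h0.
have mE n : measurable_fun setT (fun x => (h n x)%:E) by exact/measurable_EFinP.
have /(_ (cst 0) (cst M%:E))[] := @dominated_convergence _ _ _ P setT measurableT
  (fun n x => (h n x)%:E) _ _ mE.
- exact: measurable_cst.
- apply: filterS h0 => x hx _; apply: cvg_EFin; first exact: nearW.
  exact: hx.
- exact: finite_measure_integrable_cst.
- by apply: nearW => x n _; rewrite gee0_abs lee_fin; have /andP[] := hM n x.
- by move=> _ _; rewrite integral0.
Qed.

End bounded_convergence.


Lemma measurable_inv1D d (T : measurableType d) (R : realType) (h : T -> R) :
  measurable_fun setT h -> (forall x, 0 <= h x) ->
  measurable_fun setT (fun x => (1 + h x)^-1).
Proof.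
move=> mh h0.
rewrite (_ : (fun x => _) = (fun x => expR (- ln (1 + h x)))); last first.
  by apply/funext => x; rewrite expRN lnK// posrE ltr_wpDr.
apply: (measurableT_comp (@measurable_expR R)).
apply: measurableT_comp => //; apply: (measurableT_comp (@measurable_ln R)).
exact: measurable_funD.
Qed.

(** It extends to a homeomorphism between the extended real line and the closed unit
interval, so that potentials can be studied through bounded functions, whatever
their limits. *)
Definition logistic (R : realType) (a : R) : R := (1 + expR (- a))^-1.

Lemma logistic_itv (R : realType) (a : R) : 0 < logistic a < 1.
Proof.
have E0 := expR_gt0 (- a).
rewrite invr_gt0 invf_lt1; first by rewrite ltrDl E0 andbT addr_gt0.
by rewrite addr_gt0.
Qed.

Lemma logistic_le (R : realType) (a b : R) : a <= b -> logistic a <= logistic b.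
Proof.
move=> ab; rewrite lef_pV2 ?posrE ?addr_gt0 ?expR_gt0//.
by rewrite lerD2l ler_expR lerN2.
Qed.

Lemma logisticK (R : realType) (a : R) :
  ln (logistic a) - ln (1 - logistic a) = a.
Proof.
have E0 := expR_gt0 (- a).
have F0 : 0 < 1 + expR (- a) by rewrite addr_gt0.
have /andP[l0 l1] := logistic_itv a.
rewrite -ln_div ?posrE ?subr_gt0//.
have -> : logistic a / (1 - logistic a) = expR a; last by rewrite expRK.
rewrite /logistic expRN in F0 *.
have := expR_gt0 a; move: (expR a) F0 => t F0 t0; field.
by rewrite !gt_eqF//=; lra.
Qed.

(** The condition on the lower limit keeps [l] away from [0] and [1], where the
inverse of the logistic function is infinite. *)
Lemma logistic_cvg (R : realType) (a : nat -> R) (l : R) :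
  logistic (a n) @[n --> \oo] --> l ->
  (limn_einf (fun n => `|a n|%:E) < +oo)%E ->
  a n @[n --> \oo] --> ln l - ln (1 - l).
Proof.
move=> al.
rewrite limn_einf_lim (cvg_lim _ (@cvg_einfs_sup _ _))// => sup_fin.
have [A Asup] : exists A : R, (ereal_sup (range (einfs (fun n => `|a n|%:E))) < A%:E)%E.
  move: sup_fin; case: ereal_sup => [r _||_] //; last by exists 0; rewrite ltNyr.
  by exists (r + 1); rewrite lte_fin ltrDl.
have freq N : exists2 n, (N <= n)%N & `|a n| <= A.
  have : (einfs (fun n => `|a n|%:E) N < A%:E)%E.
    by apply: le_lt_trans Asup; apply: ereal_sup_ubound; exists N.
  move=> /ereal_inf_lt[_ [n /= Nn <-]]; rewrite lte_fin => /ltW anA.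
  by exists n.
have l0 : 0 < l.
  have /andP[s0 _] := logistic_itv (- A); apply: (lt_le_trans s0).
  rewrite leNgt; apply/negP => lA.
  have [N _ NP] := cvgr_lt _ al _ lA.
  have [n Nn] := freq N; rewrite ler_norml => /andP[anA _].
  by have := NP n Nn; rewrite ltNge logistic_le.
have l1 : l < 1.
  have /andP[_ s1] := logistic_itv A; apply: le_lt_trans s1.
  rewrite leNgt; apply/negP => lA.
  have [N _ NP] := cvgr_gt _ al _ lA.
  have [n Nn] := freq N; rewrite ler_norml => /andP[_ anA].
  by have := NP n Nn; rewrite ltNge logistic_le.
rewrite (_ : a = fun n => ln (logistic (a n)) - ln (1 - logistic (a n))); last first.
  by apply/funext => n; rewrite logisticK.
apply: cvgB.
  by apply: continuous_cvg al; exact: continuous_ln.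
apply: continuous_cvg; first by apply: continuous_ln; rewrite subr_gt0.
by apply: cvgB => //; exact: cvg_cst.
Qed.

(** Used with [F = exp (- f n x)] and [a * F] its truncated version, so that [1 - a]
is the conditional probability of the discarded part. *)
Lemma logistic_dist (R : realType) (F a : R) : 0 < F -> 0 <= a <= 1 ->
  `|(1 + F)^-1 - (1 + a * F)^-1| <= 1 - a.
Proof.
move=> F0 /andP[a0 a1].
have aF0 : 0 <= a * F by rewrite mulr_ge0// ltW.
have -> : (1 + F)^-1 - (1 + a * F)^-1 = - ((1 - a) * (F / ((1 + F) * (1 + a * F)))).
  by field; rewrite !gt_eqF//; lra.
rewrite normrN normrM ger0_norm ?subr_ge0// -[leRHS]mulr1 ler_wpM2l ?subr_ge0//.
rewrite ger0_norm; last by rewrite divr_ge0 ?mulr_ge0//; lra.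
rewrite ler_pdivrMr ?mulr_gt0//; [|lra|lra].
by nra.
Qed.


(** * Almost everywhere compactness of the potentials *)

Section potential_compactness.
Context d1 d2 (T1 : measurableType d1) (T2 : measurableType d2) (R : realType).
Context (c : T1 * T2 -> R) (D : nat -> T1).
Hypotheses (mc : measurable_fun setT c) (c0 : forall z, 0 <= c z).
Hypothesis cD : forall x, exists s : nat -> nat, forall y,
  c (D (s n), y) @[n --> \oo] --> c (x, y).
Context (mu_ : nat -> probability T1 R) (nu_ : nat -> probability T2 R).
Context (mu : probability T1 R) (nu : probability T2 R) (e : nat -> R).
Hypothesis e0 : e n @[n --> \oo] --> (0 : R).
Hypotheses (mu_cvg : forall n, tv_close (e n) (mu_ n) mu)
  (nu_cvg : forall n, tv_close (e n) (nu_ n) nu).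
Context (f : nat -> T1 -> R) (g : nat -> T2 -> R).
Hypotheses (mf : forall n, measurable_fun setT (f n))
  (mg : forall n, measurable_fun setT (g n)).
Context (K : R).
Hypothesis (fK : forall n, (\int[mu_ n]_x `|f n x|%:E <= K%:E)%E).
Hypothesis (gK : forall n, (\int[nu_ n]_y `|g n y|%:E <= K%:E)%E).
Hypothesis S1 : forall n, {ae mu_ n, forall x,
  (\int[nu_ n]_y (expR (f n x + g n y - c (x, y)))%:E = 1)%E}.
Hypothesis S2 : forall n, {ae nu_ n, forall y,
  (\int[mu_ n]_x (expR (f n x + g n y - c (x, y)))%:E = 1)%E}.

(* [tr n L] is [exp (g n)] cut off where [|g n| > L], and [u n L x] is
   the corresponding part of [exp (- f n x)] *)
Let k x y := expR (- c (x, y)).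
Let tr n (L : nat) y := if `|g n y| <= L%:R then expR (g n y) else 0.
Let q n L x := (\int[nu_ n]_y (tr n L y * k x y)%:E)%E.
Let u n L x := fine (q n L x).

Let mcx x : measurable_fun setT (fun y => c (x, y)).
Proof. by apply: (measurableT_comp mc); exact: measurable_pair1. Qed.

Let mkx x : measurable_fun setT (k x).
Proof.
apply: (measurableT_comp (@measurable_expR R)).
exact: measurableT_comp.
Qed.

Let mtr n L : measurable_fun setT (tr n L).
Proof.
apply: measurable_fun_ifT => //.
- by apply: measurable_fun_ler => //; exact: measurableT_comp.
- exact: measurableT_comp.
Qed.

Let k01 x y : 0 <= k x y <= 1.
Proof. by rewrite expR_ge0/= -expR0 ler_expR oppr_le0. Qed.

Let tr0 n L y : 0 <= tr n L y <= expR L%:R.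
Proof.
rewrite /tr; case: ifPn => [gL|_]; last by rewrite lexx expR_ge0.
by rewrite expR_ge0 ler_expR/= (le_trans _ gL)// ler_norm.
Qed.

Let trk0 n L x y : 0 <= tr n L y * k x y <= expR L%:R.
Proof.
have /andP[t0 tL] := tr0 n L y; have /andP[k0 k1] := k01 x y.
by rewrite mulr_ge0//= -[leRHS]mulr1 ler_pM.
Qed.

Let mtrk n L x : measurable_fun setT (fun y => (tr n L y * k x y)%:E).
Proof. by apply/measurable_EFinP; exact: measurable_funM. Qed.

Let q0 n L x : (0 <= q n L x)%E.
Proof. by apply: integral_ge0 => y _; rewrite lee_fin; have /andP[] := trk0 n L x y. Qed.

Let qL n L x : (q n L x <= (expR L%:R)%:E)%E.
Proof.
rewrite -(integral_cst_probability (nu_ n)); apply: ge0_le_integral => //.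
- by move=> y _; rewrite lee_fin; have /andP[] := trk0 n L x y.
- by move=> y _; rewrite lee_fin; have /andP[] := trk0 n L x y.
Qed.

Let qu n L x : q n L x = (u n L x)%:E.
Proof.
by rewrite fineK// ge0_fin_numE//; apply: le_lt_trans (qL n L x) (ltry _).
Qed.

Let u0L n L x : 0 <= u n L x <= expR L%:R.
Proof. by rewrite -!lee_fin -qu q0 qL. Qed.

Let u_meas n L : measurable_fun setT (u n L).
Proof.
apply: measurableT_comp => //.
have mF : measurable_fun setT (fun z : T1 * T2 => (tr n L z.2 * k z.1 z.2)%:E).
  apply/measurable_EFinP; apply: measurable_funM.
    exact: measurableT_comp.
  apply: (measurableT_comp (@measurable_expR R)).
  apply: measurableT_comp => //.
  by apply: eq_measurable_fun mc => -[].
apply: (measurable_fun_fubini_tonelli_F (m2 := nu_ n) _ mF).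
by move=> z; rewrite lee_fin; have /andP[] := trk0 n L z.1 z.2.
Qed.

Let dk x x' : \bar R := (\int[nu]_y `|k x y - k x' y|%:E)%E.

Let mdk x x' : measurable_fun setT (fun y => `|k x y - k x' y|).
Proof. by apply: measurableT_comp => //; exact: measurable_funB. Qed.

(** A modulus of continuity for [u n L] which depends on [n] only through the
vanishing error [e n]. *)
Let u_equi n L x x' :
  (`|u n L x - u n L x'|%:E <= (expR L%:R)%:E * (dk x x' + (e n)%:E))%E.
Proof.
have half y y' : (q n L y <= q n L y' + (expR L%:R)%:E * (dk y y' + (e n)%:E))%E.
  apply: (@le_trans _ _ (\int[nu_ n]_z ((tr n L z * k y' z)%:E +
      (expR L%:R)%:E * `|k y z - k y' z|%:E)))%E.
    apply: ge0_le_integral => //.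
    - by move=> z _; rewrite lee_fin; have /andP[] := trk0 n L y z.
    - apply: emeasurable_funD => //; apply: emeasurable_funM => //.
      exact/measurable_EFinP.
    - move=> z _; rewrite -EFinM -EFinD lee_fin -lerBlDl -mulrBr.
      apply: (le_trans (ler_norm _)); rewrite normrM ler_wpM2r//.
      by have /andP[t0 tL] := tr0 n L z; rewrite ger0_norm.
  rewrite ge0_integralD; [|by []| |by []| |]; first last.
  - by apply: emeasurable_funM => //; exact/measurable_EFinP.
  - by move=> z _; rewrite mule_ge0 ?lee_fin ?expR_ge0.
  - by move=> z _; rewrite lee_fin; have /andP[] := trk0 n L y' z.
  rewrite leeD2l// ge0_integralZl; [|by []| | |]; first last.
  - by rewrite lee_fin expR_ge0.
  - by move=> z _; rewrite lee_fin.
  - exact/measurable_EFinP.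
  rewrite lee_wpmul2l ?lee_fin ?expR_ge0//.
  rewrite -[e n]mul1r; apply: tv_close_integral => // z.
  rewrite normr_ge0/= ler_norml.
  by have /andP[? ?] := k01 y z; have /andP[? ?] := k01 y' z; lra.
have dkC : dk x' x = dk x x' by apply: eq_integral => z _; rewrite distrC.
have E0 : (0 <= dk x x' + (e n)%:E)%E.
  rewrite adde_ge0 ?lee_fin ?(tv_close_ge0 (mu_cvg n))//.
  by apply: integral_ge0 => z _; rewrite lee_fin.
have := half x x'; have := half x' x; rewrite dkC !qu; move: E0.
case: (dk x x' + (e n)%:E)%E => [r|_|//] /=.
  rewrite lee_fin => r0; rewrite -EFinM -!EFinD !lee_fin => ha hb.
  by rewrite ler_distl lerBlDr ha.
by move=> _ _; rewrite gt0_muley ?leey ?lte_fin ?expR_gt0.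
Qed.

(** Arzela-Ascoli: diagonal extraction over the levels [L] and the points of the
dense sequence, then equicontinuity for the other points. *)
Let u_subseq : exists phi : nat -> nat, (forall j, (j <= phi j)%N) /\
  forall L x, cvgn (fun j => u (phi j) L x).
Proof.
pose dec (i : nat) : nat * nat := odflt (0, 0)%N (unpickle i).
have [|phi [phik phiP]] := @diagonal_subsequence R
  (fun i n => u n (dec i).1 (D (dec i).2)) (fun i => expR (dec i).1%:R) _.
  by move=> i n; have /andP[? ?] := u0L n (dec i).1 (D (dec i).2); rewrite ger0_norm.
exists phi; split => // L x; apply: cvg_of_approx => eps eps0.
have [s sx] := cD x.
have dks : dk x (D (s n)) @[n --> \oo] --> (0 : \bar R)%E.
  apply: (@bounded_cvg0 _ _ _ _ _ 1) => //.
    move=> n y; rewrite normr_ge0/= ler_norml.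
    by have /andP[? ?] := k01 x y; have /andP[? ?] := k01 (D (s n)) y; lra.
  apply: nearW => y.
  have ks : k (D (s n)) y @[n --> \oo] --> k x y.
    by apply: continuous_cvg; [exact: continuous_expR|exact: cvgN].
  have : `|k x y - k (D (s n)) y| @[n --> \oo] --> `|k x y - k x y|.
    by apply: cvg_norm; apply: cvgB => //; exact: cvg_cst.
  by rewrite subrr normr0.
pose r := eps / (2 * expR L%:R).
have r0 : 0 < r by rewrite divr_gt0// mulr_gt0// expR_gt0.
have [N _ /(_ N (leqnn N)) dn] := cvge0_near_lt dks r0.
exists (fun j => u (phi j) L (D (s N))); split.
  have := phiP (pickle (L, s N)); rewrite /dec pickleK/=.
  by [].
near=> j; rewrite -lee_fin; apply: le_trans (u_equi _ _ _ _) _.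
apply: (@le_trans _ _ ((expR L%:R)%:E * (r%:E + r%:E))%E).
  rewrite lee_wpmul2l ?lee_fin ?expR_ge0// leeD//; first exact: ltW.
  by rewrite lee_fin; near: j; exact: cvg0_near_le (cvg_subseq phik e0) r0.
rewrite -EFinD -EFinM lee_fin /r.
rewrite le_eqVlt; apply/orP; left; apply/eqP; field.
by rewrite gt_eqF ?expR_gt0.
Unshelve. all: by end_near. Qed.


Let v n x := logistic (f n x).
Let w n L x := (1 + u n L x)^-1.

Let mv n : measurable_fun setT (v n).
Proof.
apply: (@measurable_inv1D _ _ _ (fun x => expR (- f n x))).
  by apply: (measurableT_comp (@measurable_expR R)); exact: measurableT_comp.
by move=> x; exact: expR_ge0.
Qed.

Let mw n L : measurable_fun setT (w n L).
Proof. by apply: measurable_inv1D => // x; have /andP[] := u0L n L x. Qed.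

Let v01 n x : 0 <= v n x <= 1.
Proof. by have /andP[a b] := logistic_itv (f n x); rewrite !ltW. Qed.

Let w01 n L x : 0 <= w n L x <= 1.
Proof.
have /andP[a _] := u0L n L x.
by rewrite invr_ge0 invf_le1 ?lerDl ?a ?addr_ge0// ltr_wpDr.
Qed.

Let Ef n x y := expR (f n x + g n y - c (x, y)).

Let EfE n x y : Ef n x y = expR (f n x) * (expR (g n y) * k x y).
Proof. by rewrite /Ef -addrA !expRD. Qed.

Let mEf n : measurable_fun setT (fun z => Ef n z.1 z.2).
Proof. by apply: eq_measurable_fun (measurable_potentials (mf n) (mg n) mc) => -[]. Qed.

Let mEx n x : measurable_fun setT (Ef n x).
Proof.
apply: (measurableT_comp (@measurable_expR R)).
by apply: measurable_funB => //; exact: measurable_funD.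
Qed.

Let mEy n y : measurable_fun setT (Ef n ^~ y).
Proof.
apply: (measurableT_comp (@measurable_expR R)).
apply: measurable_funB; first exact: measurable_funD.
by apply: (measurableT_comp mc); exact: measurable_pair2.
Qed.

(* an upper bound for the conditional probability of [|g n| > L.+1] given [x],
   in which the Markov inequality is already included *)
Let rest n (L : nat) x := (\int[nu_ n]_y (`|g n y| / L.+1%:R * Ef n x y)%:E)%E.

Let vw_rest n L : {ae mu_ n, forall x,
  (`|v n x - w n L.+1 x|%:E <= rest n L x)%E}.
Proof.
apply: filterS (S1 n) => x Sx.
pose b y := if `|g n y| <= L.+1%:R then 0 else Ef n x y.
have mb : measurable_fun setT b.
  apply: measurable_fun_ifT => //.
  by apply: measurable_fun_ler => //; exact: measurableT_comp.
have b0 y : 0 <= b y by rewrite /b; case: ifP => // _; exact: expR_ge0.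
(* the first marginal condition, split according to the size of [g n] *)
have split1 : ((expR (f n x) * u n L.+1 x)%:E + \int[nu_ n]_y (b y)%:E = 1)%E.
  rewrite -Sx EFinM -qu /q -ge0_integralZl//; last first.
    by move=> y _; rewrite lee_fin; have /andP[] := trk0 n L.+1 x y.
  rewrite -ge0_integralD; [|by []| | | |]; first last.
  - exact/measurable_EFinP.
  - by move=> y _; rewrite lee_fin.
  - by apply: emeasurable_funM => //.
  - move=> y _; rewrite mule_ge0// lee_fin ?expR_ge0//.
    by have /andP[] := trk0 n L.+1 x y.
  apply: eq_integral => y _; rewrite -EFinM -EFinD -/(Ef n x y) EfE /b /tr EfE.
  by case: ifP => _; rewrite ?addr0// mul0r mulr0 add0r.
have b_rest : (\int[nu_ n]_y (b y)%:E <= rest n L x)%E.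
  apply: ge0_le_integral => //.
  - by move=> y _; rewrite lee_fin.
  - exact/measurable_EFinP.
  - apply/measurable_EFinP; apply: measurable_funM => //.
    by apply: measurable_funM => //; exact: measurableT_comp.
  - move=> y _; rewrite lee_fin /b; case: ifPn => [_|].
      by rewrite mulr_ge0 ?divr_ge0 ?expR_ge0.
    rewrite -ltNge => gL; rewrite ler_peMl ?expR_ge0//.
    by rewrite ler_pdivlMr// mul1r ltW.
apply: le_trans b_rest; move: split1.
set a := expR (f n x) * u n L.+1 x.
have bi0 : (0 <= \int[nu_ n]_y (b y)%:E)%E.
  by apply: integral_ge0 => y _; rewrite lee_fin.
move: bi0; case: integral => [r|_|//] //.
rewrite lee_fin => r0; rewrite -EFinD => -[ar]; rewrite lee_fin.
have -> : r = 1 - a by rewrite -ar; ring.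
rewrite /v /w /logistic.
have -> : u n L.+1 x = a * expR (- f n x).
  by rewrite /a expRN mulrAC mulfV ?mul1r// gt_eqF ?expR_gt0.
apply: logistic_dist; first exact: expR_gt0.
apply/andP; split; first by rewrite /a mulr_ge0 ?expR_ge0//; have /andP[] := u0L n L.+1 x.
by rewrite -subr_ge0 (_ : 1 - a = r)// -ar; ring.
Qed.

(** The mean of [rest] is an integral against the second marginal. *)
Let rest_le n L : (\int[mu_ n]_x rest n L x <= (K / L.+1%:R)%:E)%E.
Proof.
have mG : measurable_fun setT (fun z => (`|g n z.2| / L.+1%:R * Ef n z.1 z.2)%:E).
  apply/measurable_EFinP; apply: measurable_funM => //.
  apply: measurable_funM => //; apply: measurableT_comp => //.
  exact: measurableT_comp.
have := @fubini_tonelli _ _ _ _ _ (mu_ n) (nu_ n) _ mG.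
rewrite /rest /= => ->; last first.
  by move=> z; rewrite lee_fin mulr_ge0 ?divr_ge0 ?expR_ge0.
have -> : (K / L.+1%:R)%:E = (K%:E * (L.+1%:R^-1)%:E)%E by [].
have mgE : measurable_fun setT (fun y => `|g n y|%:E).
  by apply/measurable_EFinP; exact: measurableT_comp.
apply: (@le_trans _ _ (\int[nu_ n]_y (`|g n y|%:E * (L.+1%:R^-1)%:E))%E); last first.
  rewrite ge0_integralZr//.
  by apply: lee_wpmul2r; [rewrite lee_fin invr_ge0|exact: gK].
rewrite le_eqVlt; apply/orP; left; apply/eqP; apply: ge0_ae_eq_integral => //.
- apply: (measurable_fun_fubini_tonelli_G (m1 := mu_ n) _ mG).
  by move=> z; rewrite lee_fin mulr_ge0 ?divr_ge0 ?expR_ge0.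
- exact: emeasurable_funM.
- move=> y _; apply: integral_ge0 => x _.
  by rewrite lee_fin mulr_ge0 ?divr_ge0 ?expR_ge0.
- apply: filterS (S2 n) => y Sy _.
  have mEy' : measurable_fun setT (fun x => (Ef n x y)%:E).
    exact/measurable_EFinP.
  under eq_integral do rewrite EFinM.
  rewrite ge0_integralZl//; last by move=> x _; rewrite lee_fin expR_ge0.
  by rewrite Sy mule1.
Qed.

Let vw_le n L :
  (\int[mu]_x `|v n x - w n L.+1 x|%:E <= (K / L.+1%:R + e n)%:E)%E.
Proof.
have mvw : measurable_fun setT (fun x => `|v n x - w n L.+1 x|).
  by apply: measurableT_comp => //; exact: measurable_funB.
apply: le_trans (tv_close_integral (tv_close_sym (mu_cvg n)) mvw (M := 1) _) _.
  move=> x; rewrite normr_ge0/= ler_norml.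
  by have /andP[? ?] := v01 n x; have /andP[? ?] := w01 n L.+1 x; lra.
rewrite mul1r EFinD leeD2r//; apply: le_trans (rest_le n L).
apply: ae_ge0_le_integral => //.
- exact/measurable_EFinP.
- move=> x _; apply: integral_ge0 => y _.
  by rewrite lee_fin mulr_ge0 ?divr_ge0 ?expR_ge0.
- apply: (measurable_fun_fubini_tonelli_F (m2 := nu_ n)
    (fun z => (`|g n z.2| / L.+1%:R * Ef n z.1 z.2)%:E)).
    apply/measurable_EFinP; apply: measurable_funM => //.
    apply: measurable_funM => //; apply: measurableT_comp => //.
    exact: measurableT_comp.
  by move=> z; rewrite lee_fin mulr_ge0 ?divr_ge0 ?expR_ge0.
- by apply: filterS (vw_rest n L) => x + _.
Qed.


(** [logistic (f n)] is close in [L1 mu] to [w n L], uniformly in [n] for large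
[L]; for fixed [L] the latter converges to some [W L], which decreases with [L] to
some [V].  Hence [logistic (f n)] tends to [V] in [L1 mu], then almost everywhere
after a further extraction. *)
Lemma potential_ae_subseq : exists phi : nat -> nat, (forall j, (j <= phi j)%N) /\
  exists2 F : T1 -> R, measurable_fun setT F &
    {ae mu, forall x, f (phi j) x @[j --> \oo] --> F x}.
Proof.
have [phi [jphi uphi]] := u_subseq.
pose W L x := limn (fun j => w (phi j) L x).
have wW L x : w (phi j) L x @[j --> \oo] --> W L x.
  have /cvg_ex[l ul] := uphi L x.
  have l0 : 0 <= l.
    rewrite -(cvg_lim _ ul)//; apply: limr_ge; first by apply/cvg_ex; exists l.
    apply: nearW => j.
    by have /andP[] := u0L (phi j) L x.
  apply/cvg_ex; exists (1 + l)^-1; apply: cvgV; first by rewrite gt_eqF// ltr_wpDr.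
  by apply: cvgD ul; exact: cvg_cst.
have W01 L x : 0 <= W L x <= 1.
  apply/andP; split; [apply: limr_ge|apply: limr_le].
  - by apply/cvg_ex; exists (W L x).
  - by apply: nearW => j; have /andP[] := w01 (phi j) L x.
  - by apply/cvg_ex; exists (W L x).
  - by apply: nearW => j; have /andP[] := w01 (phi j) L x.
have mW L : measurable_fun setT (W L).
  by apply: (measurable_fun_cvg (fun j => mw (phi j) L)) => x _; exact: wW.
have niW x : {homo W ^~ x : m n / (m <= n)%N >-> n <= m}.
  move=> L L' LL'; apply: (ler_lim (cvgP _ (wW L' x)) (cvgP _ (wW L x))).
  apply: nearW => j; rewrite /w lef_pV2 ?posrE.
  - rewrite lerD2l -lee_fin -!qu; apply: ge0_le_integral => //.
    + by move=> y _; rewrite lee_fin; have /andP[] := trk0 (phi j) L x y.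
    + move=> y _; rewrite lee_fin ler_wpM2r//; first by have /andP[] := k01 x y.
      rewrite /tr; case: ifPn => gL; last by case: ifP => // _; exact: expR_ge0.
      by rewrite ifT// (le_trans gL)// ler_nat.
  - by rewrite ltr_wpDr//; have /andP[] := u0L (phi j) L' x.
  - by rewrite ltr_wpDr//; have /andP[] := u0L (phi j) L x.
pose V x := limn (W ^~ x).
have WV x : W L x @[L --> \oo] --> V x.
  apply: nonincreasing_is_cvgn => //; exists 0 => _ [L _ <-].
  by have /andP[] := W01 L x.
have V01 x : 0 <= V x <= 1.
  apply/andP; split; [apply: limr_ge|apply: limr_le].
  - by apply/cvg_ex; exists (V x).
  - by apply: nearW => L; have /andP[] := W01 L x.
  - by apply/cvg_ex; exists (V x).
  - by apply: nearW => L; have /andP[] := W01 L x.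
have mV : measurable_fun setT V.
  by apply: (measurable_fun_cvg mW) => x _; exact: WV.
have dist01 (a b : R) : 0 <= a <= 1 -> 0 <= b <= 1 -> 0 <= `|a - b| <= 1.
  by move=> /andP[? ?] /andP[? ?]; rewrite normr_ge0/= ler_norml; lra.
have dist_cvg0 (a : nat -> R) (b : R) : a j @[j --> \oo] --> b ->
    `|a j - b| @[j --> \oo] --> (0 : R).
  move=> ab; rewrite -(normr0 R) -(subrr b).
  by apply: cvg_norm; apply: cvgB => //; exact: cvg_cst.
have mB (a b : T1 -> R) : measurable_fun setT a -> measurable_fun setT b ->
    measurable_fun setT (fun x => `|a x - b x|).
  by move=> ma mb; apply: measurableT_comp => //; exact: measurable_funB.
have wWL L : (\int[mu]_x `|w (phi j) L x - W L x|%:E)%E @[j --> \oo] --> (0 : \bar R)%E.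
  apply: (@bounded_cvg0 _ _ _ _ _ 1) => [j|j x|]; [exact: mB|exact: dist01|].
  by apply: nearW => x; exact: dist_cvg0.
have WVL : (\int[mu]_x `|W L.+1 x - V x|%:E)%E @[L --> \oo] --> (0 : \bar R)%E.
  apply: (@bounded_cvg0 _ _ _ _ _ 1) => [j|j x|]; [exact: mB|exact: dist01|].
  by apply: nearW => x; apply: dist_cvg0; have := WV x; rewrite -cvg_shiftS.
have K0 : 0 <= K.
  rewrite -lee_fin; apply: le_trans (fK 0); apply: integral_ge0 => x _.
  by rewrite lee_fin.
have vV : (\int[mu]_x `|v (phi j) x - V x|%:E)%E @[j --> \oo] --> (0 : \bar R)%E.
  apply: cvge0_small => [j|eps eps0].
    by apply: integral_ge0 => x _; rewrite lee_fin.
  have eps4 : 0 < eps / 4 by rewrite divr_gt0.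
  have [L [KL WVe]] : exists L : nat, K / L.+1%:R <= eps / 4 /\
      (\int[mu]_x `|W L.+1 x - V x|%:E <= (eps / 4)%:E)%E.
    have [N1 _ N1P] := cvge0_near_lt WVL eps4.
    pose N2 := Num.truncn (K / (eps / 4)).
    exists (maxn N1 N2); split; last exact: (ltW (N1P _ (leq_maxl _ _))).
    rewrite ler_pdivrMr// mulrC -ler_pdivrMr//.
    apply: le_trans (ltW (truncnS_gt _)) _.
    by rewrite ler_nat ltnS leq_maxr.
  have ephi := cvg0_near_le (cvg_subseq jphi e0) eps4.
  apply: filterS2 ephi (cvge0_near_lt (wWL L.+1) eps4) => j ej /ltW wj.
  have m1 : measurable_fun setT (fun x => `|v (phi j) x - w (phi j) L.+1 x|) by exact: mB.
  have m2 : measurable_fun setT (fun x => `|w (phi j) L.+1 x - W L.+1 x|) by exact: mB.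
  have m3 : measurable_fun setT (fun x => `|W L.+1 x - V x|) by exact: mB.
  apply: (@le_trans _ _ (\int[mu]_x (`|v (phi j) x - w (phi j) L.+1 x|%:E +
      (`|w (phi j) L.+1 x - W L.+1 x|%:E + `|W L.+1 x - V x|%:E)))%E).
    apply: ge0_le_integral => //.
    - by apply/measurable_EFinP; exact: mB.
    - apply: emeasurable_funD; first exact/measurable_EFinP.
      by apply: emeasurable_funD; exact/measurable_EFinP.
    - move=> x _; rewrite -!EFinD lee_fin.
      rewrite (le_trans (ler_distD (w (phi j) L.+1 x) _ _))// lerD2l.
      exact: ler_distD.
  have E0 (h1 h2 : T1 -> R) x : [set: T1] x -> (0 <= `|h1 x - h2 x|%:E)%E.
    by move=> _; rewrite lee_fin.
  have E1 := (measurable_EFinP _ _).2 m1; have E2 := (measurable_EFinP _ _).2 m2.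
  have E3 := (measurable_EFinP _ _).2 m3.
  rewrite (ge0_integralD mu measurableT (E0 _ _) E1 _ (emeasurable_funD E2 E3)); last first.
    by move=> x _; rewrite adde_ge0// lee_fin.
  rewrite (ge0_integralD mu measurableT (E0 _ _) E2 (E0 _ _) E3).
  apply: (@le_trans _ _ ((eps / 4 + eps / 4)%:E + ((eps / 4)%:E + (eps / 4)%:E))%E).
    apply: leeD; last exact: leeD.
    apply: le_trans (vw_le _ _) _; rewrite lee_fin; exact: lerD.
  by rewrite -!EFinD lee_fin; lra.
have [psi [jpsi vpsi]] := integral_cvg0_ae_subseq (fun j => mB _ _ (mv (phi j)) mV)
  (fun j x => normr_ge0 _) vV.
exists (phi \o psi); split => [j|]; first exact: leq_trans (jpsi j) (jphi _).
exists (fun x => ln (V x) - ln (1 - V x)).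
  apply: measurable_funB; apply: (measurableT_comp (@measurable_ln R)) => //.
  exact: measurable_funB.
pose a x j := `|f (phi (psi j)) x|.
have jpp j : (j <= phi (psi j))%N by exact: leq_trans (jpsi j) (jphi _).
have epp : e (phi (psi j)) @[j --> \oo] --> (0 : R) by exact: cvg_subseq jpp e0.
have fat : (\int[mu]_x limn_einf (fun j => (a x j)%:E) <= K%:E)%E.
  apply: (tv_fatou epp (fun j => mu_cvg (phi (psi j))) (h := fun j x => a x j)) => //.
    by move=> j; exact: measurableT_comp.
  by move=> j x; rewrite normr_ge0.
have fina : {ae mu, forall x, (limn_einf (fun j => (a x j)%:E) < +oo)%E}.
  have lim0 x : (0 <= limn_einf (fun j => (a x j)%:E))%E.
    rewrite limn_einf_lim; apply: lime_ge; first exact: is_cvg_einfs.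
    by apply: nearW => n; apply: le_ereal_inf_tmp => _ [m /= _ <-]; rewrite lee_fin normr_ge0.
  have ia : mu.-integrable setT (fun x => limn_einf (fun j => (a x j)%:E)).
    apply/integrableP; split.
      under eq_fun do rewrite limn_einf_lim.
      apply: (emeasurable_fun_cvg (fun n x => einfs (fun j => (a x j)%:E) n)).
        move=> n; apply: measurable_fun_einfs => j; apply/measurable_EFinP.
        exact: measurableT_comp.
      by move=> x _; exact: is_cvg_einfs.
    under eq_integral do rewrite gee0_abs//.
    exact: le_lt_trans fat (ltry _).
  have := integrable_ae measurableT ia; apply: filterS => x /(_ I).
  by rewrite ltey_eq => ->.
apply: filterS2 vpsi fina => x vx fx; apply: logistic_cvg fx.
rewrite /comp -/(v _ x).
have -> : V x = 0 + V x by rewrite add0r.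
under eq_fun do rewrite -[logistic _](subrK (V x)).
apply: cvgD; last exact: cvg_cst.
by apply/norm_cvg0P.
Qed.

End potential_compactness.

(** * Optimality of couplings with potentials *)

Section relative_entropy.
Context d (T : measurableType d) (R : realType) (P Q : probability T R).
Context (h : T -> R).
Hypotheses (mh : measurable_fun setT h) (h0 : forall x, (0 <= h x)%R).
Hypothesis hPQ : has_density P Q h.
Local Open Scope ereal_scope.

Lemma density_gt0_ae : {ae P, forall x, (0 < h x)%R}.
Proof.
pose N := [set x | (h x <= 0)%R].
have mN : measurable N.
  rewrite /N -[X in measurable X]setTI.
  have -> : [set x | (h x <= 0)%R] = h @^-1` `]-oo, 0%R].
    by apply/seteqP; split => x /=; rewrite in_itv.
  exact: mh.
exists N; split => //; last by move=> x /= /negP; rewrite -leNgt.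
rewrite hPQ// integral0_eq// => x Nx; congr EFin; apply/eqP.
by rewrite eq_le h0 andbT.
Qed.

Lemma rel_entropyE : rel_entropy P Q = \int[P]_x (ln (h x))%:E.
Proof.
have PQ := has_density_dominates mh h0 hPQ.
rewrite /rel_entropy asboolT//.
have mRN : measurable_fun setT (density P Q).
  exact: measurable_int (Radon_Nikodym_integrable _).
have mfRN : measurable_fun setT (fine \o density P Q) by exact: measurableT_comp.
apply: ae_eq_integral => //.
- rewrite (_ : (fun x => _) = fun x => if (fine (density P Q x) <= 0)%R then -oo
      else (ln (fine (density P Q x)))%:E); last first.
    apply/funext => x; rewrite -[in LHS](@fineK _ (density P Q x))//.
    by apply: Radon_Nikodym_fin_num; exact: PQ.
  apply: measurable_fun_ifT => //; first exact: measurable_fun_ler.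
  by apply/measurable_EFinP; exact: (measurableT_comp (@measurable_ln R) mfRN).
- by apply/measurable_EFinP; exact: measurableT_comp.
- have /(null_dominates_ae_eq measurableT PQ) :
      ae_eq Q setT (density P Q) (EFin \o h).
    by apply: filterS (has_density_ae mh h0 hPQ) => x Hx _.
  move=> H; apply: filterS2 H density_gt0_ae => x /(_ I) + hx _.
  by rewrite /= => ->; rewrite lne_EFin.
Qed.

(** [h * max (- ln h) 0 <= 1] since [ln (1 / h) <= 1 / h - 1]. *)
Lemma entropy_neg_le1 : \int[P]_x (Num.max (- ln (h x)) 0)%R%:E <= 1.
Proof.
have mm : measurable_fun setT (fun x => Num.max (- ln (h x)) 0)%R.
  apply: measurable_maxr => //.
  by apply: measurableT_comp => //; exact: measurableT_comp.
rewrite (integral_has_density mh h0 hPQ)//; last 2 first.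
- exact/measurable_EFinP.
- by move=> x; rewrite lee_fin le_max lexx orbT.
rewrite -(integral_cst_probability Q 1%R).
apply: ge0_le_integral => //.
- by move=> x _; rewrite mule_ge0 ?lee_fin// le_max lexx orbT.
- by apply: emeasurable_funM; exact/measurable_EFinP.
move=> x _; rewrite -EFinM lee_fin.
have [hx|hx] := leP (h x) 0%R.
  by have -> : h x = 0%R; [apply/le_anti; rewrite hx h0|rewrite mulr0].
rewrite -lnV ?posrE// -ler_pdivlMr//.
rewrite ge_max mul1r invr_ge0 h0 andbT.
have := expR_ge1Dx (ln (h x)^-1); rewrite lnK ?posrE ?invr_gt0//.
lra.
Qed.

End relative_entropy.

Section coupling_integral.
Context d1 d2 (T1 : measurableType d1) (T2 : measurableType d2) (R : realType).
Context (mu : probability T1 R) (nu : probability T2 R).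
Context (P : probability (T1 * T2)%type R).
Hypothesis cP : coupling mu nu P.
Local Open Scope ereal_scope.

Lemma coupling_ge0_integral_fst (k : T1 -> \bar R) :
  measurable_fun setT k -> (forall x, 0 <= k x) ->
  \int[P]_z k z.1 = \int[mu]_x k x.
Proof.
move=> mk k0; have := ge0_integral_pushforward (@measurable_fst _ _ T1 T2) P
  measurableT mk (fun x _ => k0 x).
rewrite preimage_setT => <-; apply: eq_measure_integral => A mA _.
exact: (cP.1 A mA).
Qed.

Lemma coupling_ge0_integral_snd (k : T2 -> \bar R) :
  measurable_fun setT k -> (forall x, 0 <= k x) ->
  \int[P]_z k z.2 = \int[nu]_x k x.
Proof.
move=> mk k0; have := ge0_integral_pushforward (@measurable_snd _ _ T1 T2) P
  measurableT mk (fun x _ => k0 x).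
rewrite preimage_setT => <-; apply: eq_measure_integral => A mA _.
exact: (cP.2 A mA).
Qed.

Context (F : T1 -> R) (G : T2 -> R).
Hypotheses (iF : mu.-integrable setT (EFin \o F))
  (iG : nu.-integrable setT (EFin \o G)).

Let iF1 : P.-integrable setT (fun z => (F z.1)%:E).
Proof.
have /integrableP[mF Foo] := iF; apply/integrableP; split.
  by apply: (measurableT_comp mF); exact: measurable_fst.
rewrite (coupling_ge0_integral_fst (k := fun x => `|(F x)%:E|))//.
exact: measurableT_comp.
Qed.

Let iG2 : P.-integrable setT (fun z => (G z.2)%:E).
Proof.
have /integrableP[mG Goo] := iG; apply/integrableP; split.
  by apply: (measurableT_comp mG); exact: measurable_snd.
rewrite (coupling_ge0_integral_snd (k := fun x => `|(G x)%:E|))//.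
exact: measurableT_comp.
Qed.

Lemma coupling_integrable : P.-integrable setT (fun z => (F z.1 + G z.2)%:E).
Proof. exact: (integrableD measurableT iF1 iG2). Qed.

Lemma coupling_integralD : \int[P]_z (F z.1 + G z.2)%:E =
  \int[mu]_x (F x)%:E + \int[nu]_y (G y)%:E.
Proof.
have /integrableP[mF _] := iF; have /integrableP[mG _] := iG.
transitivity (\int[P]_z ((F z.1)%:E + (G z.2)%:E)) => //.
rewrite integralD//; congr (_ + _).
- have := integral_pushforward (@measurable_fst _ _ T1 T2) (mu := P) (D := setT) mF.
  rewrite preimage_setT => /(_ iF1 measurableT) <-.
  by apply: eq_measure_integral => A mA _; exact: (cP.1 A mA).
- have := integral_pushforward (@measurable_snd _ _ T1 T2) (mu := P) (D := setT) mG.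
  rewrite preimage_setT => /(_ iG2 measurableT) <-.
  by apply: eq_measure_integral => A mA _; exact: (cP.2 A mA).
Qed.

End coupling_integral.

Section optimality.
Context d1 d2 (T1 : measurableType d1) (T2 : measurableType d2) (R : realType).
Context (mu : probability T1 R) (nu : probability T2 R).
Context (c : T1 * T2 -> R) (F : T1 -> R) (G : T2 -> R).
Hypotheses (mc : measurable_fun setT c) (c0 : forall z, (0 <= c z)%R).
Hypotheses (iF : mu.-integrable setT (EFin \o F))
  (iG : nu.-integrable setT (EFin \o G)).
Local Open Scope ereal_scope.

Let FG (z : T1 * T2) : R := (F z.1 + G z.2)%R.
Let Z (z : T1 * T2) : R := expR (FG z - c z).

Let mF : measurable_fun setT F.
Proof. by have /integrableP[/measurable_EFinP] := iF. Qed.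

Let mG : measurable_fun setT G.
Proof. by have /integrableP[/measurable_EFinP] := iG. Qed.

Let mFG : measurable_fun setT FG.
Proof. by apply: measurable_funD; exact: measurableT_comp. Qed.

Let mZ : measurable_fun setT Z.
Proof. exact: measurable_potentials. Qed.

Let Z0 z : (0 <= Z z)%R. Proof. exact: expR_ge0. Qed.

Let v := \int[mu]_x (F x)%:E + \int[nu]_y (G y)%:E.

Let v_fin : v \is a fin_num.
Proof. by rewrite fin_numD !integrable_fin_num. Qed.

(** Since [ln Z = F + G - c], the cost of [P] is formally the integral of [F + G].
The cancellation of [c] is legitimate because [c] is [P]-integrable: it is at most
[|F + G| + max (- ln Z) 0]. *)
Lemma eot_cost_potentials (P : probability (T1 * T2)%type R) :
  coupling mu nu P -> has_density P (mu \x nu) Z -> eot_cost mu nu c P = v.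
Proof.
move=> cP hP; rewrite /eot_cost (rel_entropyE mZ Z0 hP).
under [X in _ + X]eq_integral do rewrite /Z expRK.
have iFG := coupling_integrable cP iF iG.
have ic : P.-integrable setT (EFin \o c).
  apply/integrableP; split; first exact/measurable_EFinP.
  apply: (@le_lt_trans _ _ (\int[P]_z (`|(FG z)%:E| + (Num.max (- ln (Z z)) 0)%R%:E))).
    apply: ge0_le_integral => //.
    - by do 2 apply: measurableT_comp => //.
    - apply: emeasurable_funD; first by do 2 apply: measurableT_comp => //.
      apply/measurable_EFinP; apply: measurable_maxr => //.
      apply: measurableT_comp => //; exact: (measurableT_comp (@measurable_ln R)).
    - move=> z _; rewrite /= lee_fin ger0_norm// /Z expRK.
      have := ler_norm (FG z); have : (- (FG z - c z) <= Num.max (- (FG z - c z)) 0)%R.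
        by rewrite le_max lexx.
      lra.
  rewrite ge0_integralD//.
  - rewrite lte_add_pinfty//; first by have /integrableP[] := iFG.
    exact: le_lt_trans (entropy_neg_le1 mZ Z0 hP) (ltry _).
  - by do 2 apply: measurableT_comp => //.
  - by move=> z _; rewrite lee_fin le_max lexx orbT.
  - apply/measurable_EFinP; apply: measurable_maxr => //.
    apply: measurableT_comp => //; exact: (measurableT_comp (@measurable_ln R)).
have iFGc : P.-integrable setT (fun z => (FG z - c z)%:E).
  exact: (integrableB measurableT iFG ic).
rewrite -integralD// /v -(coupling_integralD cP iF iG).
by apply: eq_integral => z _; rewrite -EFinD; congr EFin; rewrite /FG; ring.
Qed.

(** With [h] the density of [rho] and [s = c + ln h - (F + G) = ln (h / Z)], the
cost of [rho] is [v + \int s drho].  The inequality [1 - s <= exp (- s)], where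
[exp (- s)] has integral at most [1] under [rho], gives [\int s drho >= 0]; in case
of equality [s = 0] almost everywhere, that is [h = Z]. *)
Lemma eot_cost_ge_potentials (rho P : probability (T1 * T2)%type R) :
  coupling mu nu rho -> has_density P (mu \x nu) Z ->
  v <= eot_cost mu nu c rho /\
  (eot_cost mu nu c rho = v -> forall A, measurable A -> rho A = P A).
Proof.
move=> crho hP.
have ic0 : 0 <= \int[rho]_z (c z)%:E by apply: integral_ge0 => z _; rewrite lee_fin.
have [rhoQ|nrhoQ] := pselect (rho `<< mu \x nu); last first.
  rewrite /eot_cost /rel_entropy asboolF// addey ?leey//; last first.
    by apply: contraTneq ic0 => ->.
  by split => // voo; move: v_fin; rewrite -voo.
have [h [mh h0 hrho]] : exists h : T1 * T2 -> R,
    [/\ measurable_fun setT h, forall z, (0 <= h z)%R & has_density rho (mu \x nu) h].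
  exact: dominates_has_density.
rewrite /eot_cost (rel_entropyE mh h0 hrho).
have mL : measurable_fun setT (fun z => ln (h z)).
  exact: (measurableT_comp (@measurable_ln R)).
have LNy : -oo < \int[rho]_z (ln (h z))%:E.
  rewrite integralE; set p := \int[rho]_z _.
  have p0 : 0 <= p by exact: integral_ge0.
  apply: (@lt_le_trans _ _ (0 - 1)); first by rewrite sub0e ltNyr.
  apply: leeB => //; apply: le_trans (entropy_neg_le1 mh h0 hrho).
  by rewrite le_eqVlt; apply/orP; left; apply/eqP; apply: eq_integral => z _;
    rewrite funenegE -EFinN -EFin_max.
have [->|Coo] := eqVneq (\int[rho]_z (c z)%:E + \int[rho]_z (ln (h z))%:E) +oo.
  by rewrite leey; split => // voo; move: v_fin; rewrite -voo.
have [cfin Lfin] : \int[rho]_z (c z)%:E \is a fin_num /\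
    \int[rho]_z (ln (h z))%:E \is a fin_num.
  move: ic0 LNy Coo; case: (\int[rho]_z (c z)%:E) => [r| |] //;
    by case: (\int[rho]_z (ln (h z))%:E) => [t| |].
have ic : rho.-integrable setT (EFin \o c).
  apply/integrableP; split; first exact/measurable_EFinP.
  by rewrite integral_fin_num_abs.
have iL : rho.-integrable setT (fun z => (ln (h z))%:E).
  apply/integrableP; split; first exact/measurable_EFinP.
  by rewrite integral_fin_num_abs.
have iFG := coupling_integrable crho iF iG.
pose s z := (c z + ln (h z) - FG z)%R.
have ms : measurable_fun setT s.
  by apply: measurable_funB => //; exact: measurable_funD.
have icL : rho.-integrable setT (fun z => (c z + ln (h z))%:E).
  exact: (integrableD measurableT ic iL).
have is_ : rho.-integrable setT (EFin \o s) by exact: (integrableB measurableT icL iFG).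
have costE : \int[rho]_z (c z)%:E + \int[rho]_z (ln (h z))%:E =
    \int[rho]_z (s z)%:E + v.
  rewrite /v -(coupling_integralD crho iF iG) -integralD// -[RHS]integralD//.
  by apply: eq_integral => z _; rewrite -!EFinD; congr EFin; rewrite /s /FG; ring.
have mes : measurable_fun setT (fun z => (expR (- s z))%:E).
  apply/measurable_EFinP; apply: (measurableT_comp (@measurable_expR R)).
  exact: measurableT_comp.
have hZ z : (expR (- s z) * h z <= Z z)%R.
  have [hz|hz] := leP (h z) 0%R.
    by have -> : h z = 0%R; [apply/le_anti; rewrite hz h0|rewrite mulr0].
  rewrite -[X in (_ * X)%R](@lnK R); last by rewrite posrE.
  by rewrite -expRD /s /Z ler_expR; lra.
have es1 : \int[rho]_z (expR (- s z))%:E <= 1.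
  rewrite (integral_has_density mh h0 hrho)//.
  rewrite -(@probability_setT _ _ _ P) hP//; apply: ge0_le_integral => //.
  - by move=> z _; rewrite mule_ge0 ?lee_fin ?expR_ge0.
  - by apply: emeasurable_funM => //; exact/measurable_EFinP.
  - exact/measurable_EFinP.
  - by move=> z _; rewrite -EFinM lee_fin.
have es0 : 0 <= \int[rho]_z (expR (- s z))%:E.
  by apply: integral_ge0 => z _; rewrite lee_fin expR_ge0.
have ies : rho.-integrable setT (EFin \o (fun z => expR (- s z))).
  apply/integrableP; split => //.
  under eq_integral do rewrite /= ger0_norm ?expR_ge0//.
  exact: le_lt_trans es1 (ltry _).
(* the gap in the convexity inequality for the exponential *)
pose w z := (expR (- s z) - (1 + - s z))%R.
have w0 z : (0 <= w z)%R by rewrite subr_ge0 expR_ge1Dx.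
have mw : measurable_fun setT w.
  apply: measurable_funB; first exact/measurable_EFinP.
  by apply: measurable_funD => //; exact: measurableT_comp.
have i1s : rho.-integrable setT (EFin \o (fun z => (1 + - s z)%R)).
  apply: (integrableB measurableT _ is_ (f := cst 1)).
  exact: finite_measure_integrable_cst.
have wE : \int[rho]_z (w z)%:E =
    \int[rho]_z (expR (- s z))%:E - (1 - \int[rho]_z (s z)%:E).
  rewrite -[X in _ - (X - _)](integral_cst_probability rho 1%R).
  rewrite -[X in _ = _ - X]integralB//; last exact: finite_measure_integrable_cst.
  by rewrite -[RHS]integralB//; exact: i1s.
have W0 : 0 <= \int[rho]_z (w z)%:E by apply: integral_ge0 => z _; rewrite lee_fin.
have esfin : \int[rho]_z (expR (- s z))%:E \is a fin_num by exact: integrable_fin_num.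
have sfin : \int[rho]_z (s z)%:E \is a fin_num by exact: integrable_fin_num.
have ints0 : 0 <= \int[rho]_z (s z)%:E.
  move: W0 es1; rewrite wE -(fineK esfin) -(fineK sfin) -!EFinB !lee_fin; lra.
rewrite costE; split; first by rewrite leeDr.
move=> sv.
have s0 : \int[rho]_z (s z)%:E = 0.
  by move: sv; rewrite -(fineK sfin) -(fineK v_fin) -EFinD => -[] ?; congr EFin; lra.
have W00 : \int[rho]_z (w z)%:E = 0.
  apply/le_anti; rewrite W0 andbT wE s0 sube0.
  by move: es1; rewrite -(fineK esfin) -EFinB !lee_fin; lra.
have aes : {ae rho, forall z, s z = 0%R}.
  have := (@ae_eq_integral_abs _ _ _ rho setT measurableT (EFin \o w) _).1.
  move=> /(_ _ _)[||N [mN N0 sN]].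
  - exact/measurable_EFinP.
  - by under eq_integral do rewrite gee0_abs ?lee_fin//.
  exists N; split => // z /= sz; apply: sN => /= wz; apply: sz.
  have [//|/eqP sz] := pselect (s z = 0%R).
  have : (- s z != 0)%R by rewrite oppr_eq0.
  move=> /expR_gt1Dx; rewrite -subr_gt0 -/(w z).
  by have := wz I => -[] ->; rewrite ltxx.
have [N [mN N0 sN]] := aes.
(* an inequality between two probabilities that holds for all sets is an equality *)
have le_rhoP A : measurable A -> rho A <= P A.
  move=> mA; have mAN : measurable (A `\` N) by exact: measurableD.
  apply: (@le_trans _ _ (rho (A `\` N))).
    rewrite [leLHS](measureDI rho mA mN).
    rewrite [X in _ + X](_ : _ = 0); first by rewrite adde0.
    apply/eqP; rewrite -measure_le0 -N0; apply: le_measure; rewrite ?inE//.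
    exact: measurableI.
  apply: (@le_trans _ _ (P (A `\` N))); last first.
    by apply: le_measure; rewrite ?inE//; exact: subDsetl.
  rewrite hrho// hP//; apply: ge0_le_integral => //.
  - by move=> z _; rewrite lee_fin.
  - by apply/measurable_EFinP; exact: measurable_funTS.
  - by apply/measurable_EFinP; exact: measurable_funTS.
  - move=> z [_ Nz]; rewrite lee_fin; have := hZ z.
    have -> : s z = 0%R by apply: contrapT => /sN.
    by rewrite oppr0 expR0 mul1r.
move=> A mA; apply/le_anti; rewrite le_rhoP//=.
have := le_rhoP _ (measurableC mA); rewrite !probability_setC//.
rewrite -(fineK (fin_num_measure P A mA)) -(fineK (fin_num_measure rho A mA)).
rewrite -!EFinB !lee_fin; lra.
Qed.

End optimality.

(** * Marginal conditions and bounds for the potentials *)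

Section potentials_coupling.
Context d1 d2 (T1 : measurableType d1) (T2 : measurableType d2) (R : realType).
Context (mu : probability T1 R) (nu : probability T2 R).
Context (P : probability (T1 * T2)%type R).
Context (c : T1 * T2 -> R) (f : T1 -> R) (g : T2 -> R).
Hypotheses (mc : measurable_fun setT c) (c0 : forall z, (0 <= c z)%R).
Hypotheses (mf : measurable_fun setT f) (mg : measurable_fun setT g).
Hypothesis cP : coupling mu nu P.
Local Open Scope ereal_scope.

Let Z (z : T1 * T2) : R := expR (f z.1 + g z.2 - c z).
Hypothesis hP : has_density P (mu \x nu) Z.

Let mZ : measurable_fun setT Z.
Proof. exact: measurable_potentials. Qed.

Let Z0 z : (0 <= Z z)%R. Proof. exact: expR_ge0. Qed.

(** By the Tonelli theorem this integral is the density of the first marginal of [P]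
with respect to [mu], and that marginal is [mu]. *)
Lemma potentials_marginal1 :
  {ae mu, forall x, \int[nu]_y (expR (f x + g y - c (x, y)))%:E = 1}.
Proof.
have mZ' : measurable_fun setT (EFin \o Z) by exact/measurable_EFinP.
have ZF0 z : 0 <= (EFin \o Z) z by rewrite lee_fin.
pose k x := \int[nu]_y (Z (x, y))%:E.
have k0 x : 0 <= k x by apply: integral_ge0 => y _; rewrite lee_fin.
have mk : measurable_fun setT k.
  exact: (measurable_fun_fubini_tonelli_F (m2 := nu) _ mZ').
have mZx x : measurable_fun setT (fun y => (Z (x, y))%:E).
  by apply: (measurableT_comp mZ'); exact: measurable_pair1.
have := @integral_ae_eq _ _ _ mu setT measurableT k (cst 1).
move=> /(_ _ mk)[||N [mN N0 sN]].
- exact: finite_measure_integrable_cst.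
- move=> A _ mA; have mI : measurable_fun setT (fun x => (\1_A x : R)%:E).
    by apply/measurable_EFinP; exact: measurable_indic.
  rewrite integral_cst// mul1e.
  transitivity (P (fst @^-1` A)); first by rewrite (cP.1 A mA).
  transitivity (\int[P]_z (\1_A z.1)%:E).
    rewrite (coupling_ge0_integral_fst cP mI); last by move=> x; rewrite lee_fin.
    by rewrite integral_indic// setIT (cP.1 A mA).
  have mI1 : measurable_fun setT (fun z : T1 * T2 => (\1_A z.1 : R)%:E).
    by apply: (measurableT_comp mI); exact: measurable_fst.
  rewrite (integral_has_density mZ Z0 hP mI1); last by move=> z; rewrite lee_fin.
  rewrite fubini_tonelli1; last 2 first.
  - by apply: emeasurable_funM.
  - by move=> z; rewrite mule_ge0 ?lee_fin.
  rewrite [RHS]integral_mkcond; apply: eq_integral => x _.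
  rewrite /fubini_F /= ge0_integralZl//; last by move=> y _; rewrite lee_fin.
  by rewrite epatch_indic /= muleC.
- by exists N; split => // x /= kx; apply: sN => /= /(_ I) ?; apply: kx.
Qed.

Lemma potentials_marginal2 :
  {ae nu, forall y, \int[mu]_x (expR (f x + g y - c (x, y)))%:E = 1}.
Proof.
have mZ' : measurable_fun setT (EFin \o Z) by exact/measurable_EFinP.
have ZF0 z : 0 <= (EFin \o Z) z by rewrite lee_fin.
pose k y := \int[mu]_x (Z (x, y))%:E.
have k0 x : 0 <= k x by apply: integral_ge0 => y _; rewrite lee_fin.
have mk : measurable_fun setT k.
  exact: (measurable_fun_fubini_tonelli_G (m1 := mu) _ mZ').
have mZy y : measurable_fun setT (fun x => (Z (x, y))%:E).
  by apply: (measurableT_comp mZ'); exact: measurable_pair2.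
have := @integral_ae_eq _ _ _ nu setT measurableT k (cst 1).
move=> /(_ _ mk)[||N [mN N0 sN]].
- exact: finite_measure_integrable_cst.
- move=> A _ mA; have mI : measurable_fun setT (fun x => (\1_A x : R)%:E).
    by apply/measurable_EFinP; exact: measurable_indic.
  rewrite integral_cst// mul1e.
  transitivity (P (snd @^-1` A)); first by rewrite (cP.2 A mA).
  transitivity (\int[P]_z (\1_A z.2)%:E).
    rewrite (coupling_ge0_integral_snd cP mI); last by move=> x; rewrite lee_fin.
    by rewrite integral_indic// setIT (cP.2 A mA).
  have mI1 : measurable_fun setT (fun z : T1 * T2 => (\1_A z.2 : R)%:E).
    by apply: (measurableT_comp mI); exact: measurable_snd.
  rewrite (integral_has_density mZ Z0 hP mI1); last by move=> z; rewrite lee_fin.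
  rewrite fubini_tonelli2; last 2 first.
  - by apply: emeasurable_funM.
  - by move=> z; rewrite mule_ge0 ?lee_fin.
  rewrite [RHS]integral_mkcond; apply: eq_integral => x _.
  rewrite /fubini_G /= ge0_integralZl//; last by move=> y _; rewrite lee_fin.
  by rewrite epatch_indic /= muleC.
- by exists N; split => // x /= kx; apply: sN => /= /(_ I) ?; apply: kx.
Qed.

(** Pointwise, [|f|] and [|g|] are both at most the sum of the positive parts of [f]
and [g] and of the negative part of [ln Z], as [f + g = c + ln Z >= ln Z]; the last
of these three terms is controlled by [entropy_neg_le1]. *)
Lemma potentials_L1 (K : R) :
  \int[mu]_x (Num.max (f x) 0)%R%:E <= K%:E ->
  \int[nu]_y (Num.max (g y) 0)%R%:E <= K%:E ->
  \int[mu]_x `|f x|%R%:E <= (K + K + 1)%:E /\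
  \int[nu]_y `|g y|%R%:E <= (K + K + 1)%:E.
Proof.
move=> fK gK.
have mfp : measurable_fun setT (fun x => (Num.max (f x) 0)%R%:E).
  by apply/measurable_EFinP; exact: measurable_maxr.
have mgp : measurable_fun setT (fun x => (Num.max (g x) 0)%R%:E).
  by apply/measurable_EFinP; exact: measurable_maxr.
have max0 (a : R) : 0 <= (Num.max a 0)%R%:E by rewrite lee_fin le_max lexx orbT.
have mfp1 : measurable_fun setT (fun z : T1 * T2 => (Num.max (f z.1) 0)%R%:E).
  by apply: (measurableT_comp mfp); exact: measurable_fst.
have mgp2 : measurable_fun setT (fun z : T1 * T2 => (Num.max (g z.2) 0)%R%:E).
  by apply: (measurableT_comp mgp); exact: measurable_snd.
have mlZ : measurable_fun setT (fun z => (Num.max (- ln (Z z)) 0)%R%:E).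
  apply/measurable_EFinP; apply: measurable_maxr => //.
  apply: measurableT_comp => //; exact: (measurableT_comp (@measurable_ln R)).
have sumle : \int[P]_z ((Num.max (f z.1) 0)%R%:E + (Num.max (g z.2) 0)%R%:E +
    (Num.max (- ln (Z z)) 0)%R%:E) <= (K + K + 1)%:E.
  rewrite ge0_integralD//; last 2 first.
  - by move=> z _; rewrite adde_ge0.
  - exact: emeasurable_funD.
  rewrite ge0_integralD// !EFinD; apply: leeD; last exact: entropy_neg_le1 hP.
  apply: leeD.
  - by rewrite (coupling_ge0_integral_fst cP mfp)// => x; exact: max0.
  - by rewrite (coupling_ge0_integral_snd cP mgp)// => x; exact: max0.
have mfg : measurable_fun setT (fun z => (Num.max (f z.1) 0)%R%:E +
    (Num.max (g z.2) 0)%R%:E + (Num.max (- ln (Z z)) 0)%R%:E).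
  by do 2 apply: emeasurable_funD => //.
have key z : (`|f z.1| <= Num.max (f z.1) 0 + Num.max (g z.2) 0 + Num.max (- ln (Z z)) 0)%R /\
    (`|g z.2| <= Num.max (f z.1) 0 + Num.max (g z.2) 0 + Num.max (- ln (Z z)) 0)%R.
  rewrite /Z expRK; have := c0 z.
  have m1 (a : R) : (a <= Num.max a 0 /\ 0 <= Num.max a 0)%R.
    by rewrite !le_max !lexx orbT.
  have [? ?] := m1 (f z.1); have [? ?] := m1 (g z.2).
  have [? ?] := m1 (- (f z.1 + g z.2 - c z))%R.
  by move=> ?; split; rewrite ler_norml; lra.
split.
- have maf : measurable_fun setT (fun x => `|f x|%R%:E).
    by apply/measurable_EFinP; exact: measurableT_comp.
  rewrite -(coupling_ge0_integral_fst cP maf); last by move=> x; rewrite lee_fin.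
  apply: le_trans sumle; apply: ge0_le_integral => //.
  + by apply: (measurableT_comp maf); exact: measurable_fst.
  + by move=> z _; rewrite -!EFinD lee_fin; have [] := key z.
- have mag : measurable_fun setT (fun x => `|g x|%R%:E).
    by apply/measurable_EFinP; exact: measurableT_comp.
  rewrite -(coupling_ge0_integral_snd cP mag); last by move=> x; rewrite lee_fin.
  apply: le_trans sumle; apply: ge0_le_integral => //.
  + by apply: (measurableT_comp mag); exact: measurable_snd.
  + by move=> z _; rewrite -!EFinD lee_fin; have [] := key z.
Qed.

End potentials_coupling.

(** * Limits of couplings with convergent potentials *)

Lemma ae_prod_fst d1 d2 (T1 : measurableType d1) (T2 : measurableType d2)
    (R : realType) (mu : probability T1 R) (nu : probability T2 R) (A : T1 -> Prop) :
  {ae mu, forall x, A x} -> {ae (mu \x nu)%E, forall z, A z.1}.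
Proof.
move=> [N [mN N0 sN]]; exists (N `*` setT); split.
- exact: measurableX.
- transitivity (mu N * nu setT)%E; first exact: product_measure1E.
  by rewrite N0 mul0e.
- by move=> z /= nAz; split => //; exact: sN.
Qed.

Lemma ae_prod_snd d1 d2 (T1 : measurableType d1) (T2 : measurableType d2)
    (R : realType) (mu : probability T1 R) (nu : probability T2 R) (A : T2 -> Prop) :
  {ae nu, forall y, A y} -> {ae (mu \x nu)%E, forall z, A z.2}.
Proof.
move=> [N [mN N0 sN]]; exists (setT `*` N); split.
- exact: measurableX.
- transitivity (mu setT * nu N)%E; first exact: product_measure1E.
  by rewrite N0 mule0.
- by move=> z /= nAz; split => //; exact: sN.
Qed.

Lemma tv_fatou_cvg d (T : measurableType d) (R : realType)
    (P_ : nat -> probability T R) (P : probability T R) (e : nat -> R)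
    (h : nat -> T -> R) (H : T -> R) (K : R) :
  e n @[n --> \oo] --> 0 -> (forall n, tv_close (e n) (P_ n) P) ->
  (forall n, measurable_fun setT (h n)) -> (forall n x, 0 <= h n x) ->
  measurable_fun setT H -> (forall x, 0 <= H x) ->
  {ae P, forall x, h n x @[n --> \oo] --> H x} ->
  (forall n, (\int[P_ n]_x (h n x)%:E <= K%:E)%E) ->
  (\int[P]_x (H x)%:E <= K%:E)%E.
Proof.
move=> e0 PP mh h0 mH H0 hH hK.
apply: le_trans (tv_fatou e0 PP mh h0 hK).
apply: ae_ge0_le_integral => //.
- by move=> x _; rewrite lee_fin.
- exact/measurable_EFinP.
- move=> x _; rewrite limn_einf_lim; apply: lime_ge; first exact: is_cvg_einfs.
  by apply: nearW => n; apply: le_ereal_inf_tmp => _ [m /= _ <-]; rewrite lee_fin.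
- under eq_fun do rewrite limn_einf_lim.
  apply: (emeasurable_fun_cvg (fun n x => einfs (fun m => (h m x)%:E) n)).
    by move=> n; apply: measurable_fun_einfs => m; exact/measurable_EFinP.
  by move=> x _; exact: is_cvg_einfs.
- apply: filterS hH => x hx _.
  have : (h n x)%:E @[n --> \oo] --> (H x)%:E.
    by apply: cvg_EFin; [exact: nearW|exact: hx].
  by move=> /cvg_limn_einf_sup[-> _].
Qed.

Section tv_limit.
Context d1 d2 (T1 : measurableType d1) (T2 : measurableType d2) (R : realType).
Context (c : T1 * T2 -> R).
Hypotheses (mc : measurable_fun setT c) (c0 : forall z, 0 <= c z).
Context (mu_ : nat -> probability T1 R) (nu_ : nat -> probability T2 R).
Context (mu : probability T1 R) (nu : probability T2 R) (e : nat -> R).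
Hypothesis e0 : e n @[n --> \oo] --> (0 : R).
Hypotheses (mu_cvg : forall n, tv_close (e n) (mu_ n) mu)
  (nu_cvg : forall n, tv_close (e n) (nu_ n) nu).
Context (f : nat -> T1 -> R) (g : nat -> T2 -> R).
Hypotheses (mf : forall n, measurable_fun setT (f n))
  (mg : forall n, measurable_fun setT (g n)).
Context (pi_ : nat -> probability (T1 * T2)%type R).
Hypothesis cpi : forall n, coupling (mu_ n) (nu_ n) (pi_ n).
Let Zn n (z : T1 * T2) : R := expR (f n z.1 + g n z.2 - c z).
Hypothesis hpi : forall n, has_density (pi_ n) (mu_ n \x nu_ n)%E (Zn n).
Context (K : R).
Hypothesis (fK : forall n, (\int[mu_ n]_x `|f n x|%:E <= K%:E)%E).
Hypothesis (gK : forall n, (\int[nu_ n]_y `|g n y|%:E <= K%:E)%E).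
Context (F : T1 -> R) (G : T2 -> R).
Hypotheses (mF : measurable_fun setT F) (mG : measurable_fun setT G).
Hypothesis fF : {ae mu, forall x, f n x @[n --> \oo] --> F x}.
Hypothesis gG : {ae nu, forall y, g n y @[n --> \oo] --> G y}.

Lemma tv_limit_integrable1 : mu.-integrable setT (EFin \o F).
Proof.
apply/integrableP; split; first exact/measurable_EFinP.
have := @tv_fatou_cvg _ _ _ mu_ mu e (fun n x => `|f n x|) (fun x => `|F x|) K e0 mu_cvg.
move=> H; apply: le_lt_trans (H _ _ _ _ _ fK) (ltry _) => //.
- by move=> n; exact: measurableT_comp.
- exact: measurableT_comp.
- by apply: filterS fF => x; exact: cvg_norm.
Qed.

Lemma tv_limit_integrable2 : nu.-integrable setT (EFin \o G).
Proof.
apply/integrableP; split; first exact/measurable_EFinP.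
have := @tv_fatou_cvg _ _ _ nu_ nu e (fun n x => `|g n x|) (fun x => `|G x|) K e0 nu_cvg.
move=> H; apply: le_lt_trans (H _ _ _ _ _ gK) (ltry _) => //.
- by move=> n; exact: measurableT_comp.
- exact: measurableT_comp.
- by apply: filterS gG => x; exact: cvg_norm.
Qed.

Let Z (z : T1 * T2) : R := expR (F z.1 + G z.2 - c z).
Let Q : probability (T1 * T2)%type R := (mu \x nu)%E.
Let Qn n : probability (T1 * T2)%type R := (mu_ n \x nu_ n)%E.

Let QnQ n : tv_close (e n + e n) (Qn n) Q.
Proof. exact: tv_close_prod. Qed.

Let e20 : (e n + e n) @[n --> \oo] --> (0 : R).
Proof. by rewrite -[X in _ --> X](addr0 0); exact: cvgD. Qed.

Let mZn n : measurable_fun setT (Zn n).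
Proof. exact: measurable_potentials. Qed.

Let mZ : measurable_fun setT Z.
Proof. exact: measurable_potentials. Qed.

Let Zn0 n z : 0 <= Zn n z. Proof. exact: expR_ge0. Qed.
Let Z0 z : 0 <= Z z. Proof. exact: expR_ge0. Qed.

Let ZnZ : {ae Q, forall z, Zn n z @[n --> \oo] --> Z z}.
Proof.
apply: filterS2 (ae_prod_fst nu fF) (ae_prod_snd mu gG) => z fz gz.
apply: continuous_cvg; first exact: continuous_expR.
by apply: cvgB; [exact: cvgD|exact: cvg_cst].
Qed.

Let Z_le1 : (\int[Q]_z (Z z)%:E <= 1%:E)%E.
Proof.
apply: (@tv_fatou_cvg _ _ _ Qn Q _ Zn Z 1 e20 QnQ mZn Zn0 mZ Z0 ZnZ) => n.
by rewrite -hpi// probability_setT.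
Qed.

(** Cut [A] along [|f n|, |g n| <= L.+1]: the outside has mass at most
[2 * K / L.+1], by the Markov inequality; inside, the density [tn n] is bounded, so
that the reference measures can be exchanged, and it exceeds [Z] by [wn n], whose
integral tends to [0] by bounded convergence. *)
Let pi_le (eps : R) : 0 < eps -> \forall n \near \oo, forall A, measurable A ->
  (pi_ n A <= \int[Q]_(z in A) (Z z)%:E + eps%:E)%E.
Proof.
move=> eps0; have eps4 : 0 < eps / 4 by rewrite divr_gt0.
have K0 : 0 <= K.
  rewrite -lee_fin; apply: le_trans (fK 0); apply: integral_ge0 => x _.
  by rewrite lee_fin.
pose L : nat := Num.truncn (K / (eps / 4)).
have KL : K / L.+1%:R <= eps / 4.
  rewrite ler_pdivrMr// mulrC -ler_pdivrMr//; exact: ltW (truncnS_gt _).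
pose M := expR (L.+1%:R + L.+1%:R) : R.
pose tn n z := if (`|f n z.1| <= L.+1%:R) && (`|g n z.2| <= L.+1%:R)
  then Zn n z else 0.
have mtn n : measurable_fun setT (tn n).
  apply: measurable_fun_ifT => //; apply: measurable_and; apply: measurable_fun_ler => //;
    do 2 apply: measurableT_comp => //.
have tn0 n z : 0 <= tn n z <= M.
  rewrite /tn; case: ifPn => [/andP[fL gL]|_]; last by rewrite lexx expR_ge0.
  rewrite Zn0 ler_expR/=; have := c0 z.
  have := le_trans (ler_norm _) fL; have := le_trans (ler_norm _) gL; lra.
pose wn n z := Num.max (tn n z - Z z) 0.
have mwn n : measurable_fun setT (wn n).
  by apply: measurable_maxr => //; exact: measurable_funB.
have wn0 n z : 0 <= wn n z <= M.
  have /andP[t0 tM] := tn0 n z; have := Z0 z => Zz.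
  rewrite /wn le_max lexx orbT/= ge_max; apply/andP; split; lra.
have wcvg : (\int[Q]_z (wn n z)%:E)%E @[n --> \oo] --> (0 : \bar R)%E.
  apply: (bounded_cvg0 mwn wn0); apply: filterS ZnZ => z Zz.
  apply/cvgrPdist_le => r r0; have /cvgrPdist_le/(_ _ r0) := Zz.
  apply: filterS => n; rewrite sub0r normrN /wn => Zr.
  rewrite ger0_norm ?le_max ?lexx ?orbT// ge_max (ltW r0) andbT.
  move: Zr; rewrite ler_norml /tn; have := Z0 z; case: ifP => _; lra.
have Me0 : (M * (e n + e n)) @[n --> \oo] --> (0 : R).
  by rewrite -(mulr0 M); apply: cvgM => //; exact: cvg_cst.
apply: filterS2 (cvge0_near_lt wcvg eps4) (cvg0_near_le Me0 eps4) => n /ltW wne Mne A mA.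
pose rn z := (`|f n z.1| / L.+1%:R + `|g n z.2| / L.+1%:R).
have mE1 : measurable_fun setT (fun x => (`|f n x|%:E * (L.+1%:R^-1)%:E)%E).
  by apply: emeasurable_funM => //; apply/measurable_EFinP; exact: measurableT_comp.
have mE2 : measurable_fun setT (fun x => (`|g n x|%:E * (L.+1%:R^-1)%:E)%E).
  by apply: emeasurable_funM => //; apply/measurable_EFinP; exact: measurableT_comp.
have mrn : measurable_fun setT (EFin \o rn).
  apply/measurable_EFinP; apply: measurable_funD; apply: measurable_funM => //;
    by do 2 apply: measurableT_comp => //.
have rn0 z : 0 <= rn z by rewrite addr_ge0// divr_ge0.
have rn_le : (\int[pi_ n]_z (rn z)%:E <= (eps / 4 + eps / 4)%:E)%E.
  under eq_integral do rewrite /rn EFinD !EFinM.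
  rewrite ge0_integralD; [|by []| | | |]; first last.
  - by apply: (measurableT_comp mE2); exact: measurable_snd.
  - by move=> z _; rewrite mule_ge0 ?lee_fin.
  - by apply: (measurableT_comp mE1); exact: measurable_fst.
  - by move=> z _; rewrite mule_ge0 ?lee_fin.
  rewrite (coupling_ge0_integral_fst (cpi n) mE1); last first.
    by move=> z; rewrite mule_ge0 ?lee_fin.
  rewrite (coupling_ge0_integral_snd (cpi n) mE2); last first.
    by move=> z; rewrite mule_ge0 ?lee_fin.
  rewrite EFinD; apply: leeD.
  - rewrite ge0_integralZr//; last first.
      by apply/measurable_EFinP; exact: measurableT_comp.
    apply: (@le_trans _ _ (K%:E * (L.+1%:R^-1)%:E)%E); last by rewrite -EFinM lee_fin.
    by apply: lee_wpmul2r; [rewrite lee_fin invr_ge0|exact: fK].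
  - rewrite ge0_integralZr//; last first.
      by apply/measurable_EFinP; exact: measurableT_comp.
    apply: (@le_trans _ _ (K%:E * (L.+1%:R^-1)%:E)%E); last by rewrite -EFinM lee_fin.
    by apply: lee_wpmul2r; [rewrite lee_fin invr_ge0|exact: gK].
pose IA z := (\1_A z : R).
have mIA : measurable_fun setT IA by exact: measurable_indic.
have IA01 z : 0 <= IA z <= 1 by rewrite /IA indicE; case: (_ \in _); rewrite lexx ler01.
have mIt : measurable_fun setT (fun z => IA z * tn n z) by exact: measurable_funM.
have It0 z : 0 <= IA z * tn n z <= M.
  have /andP[a b] := IA01 z; have /andP[t0 tM] := tn0 n z.
  by rewrite mulr_ge0//= -[leRHS]mul1r ler_pM.
have Zsplit z : IA z * Zn n z <= IA z * tn n z + rn z * Zn n z.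
  have /andP[a b] := IA01 z; rewrite /tn; case: ifPn => [_|].
    by rewrite lerDl mulr_ge0.
  rewrite mulr0 add0r => fgL; rewrite ler_wpM2r//; apply: (le_trans b).
  move: fgL; rewrite negb_and -!ltNge => /orP[|] H; rewrite /rn.
    by rewrite ler_wpDr ?divr_ge0// ler_pdivlMr// mul1r ltW.
  by rewrite ler_wpDl ?divr_ge0// ler_pdivlMr// mul1r ltW.
have step1 : (pi_ n A <= \int[Qn n]_z (IA z * tn n z)%:E + (eps / 4 + eps / 4)%:E)%E.
  have -> : (pi_ n A = \int[Qn n]_z (IA z * Zn n z)%:E)%E.
    rewrite hpi// integral_mkcond; apply: eq_integral => z _.
    by rewrite epatch_indic /= -EFinM mulrC.
  apply: (@le_trans _ _ (\int[Qn n]_z ((IA z * tn n z)%:E + (rn z * Zn n z)%:E))%E).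
    apply: ge0_le_integral => //.
    - by move=> z _; rewrite lee_fin mulr_ge0//; have /andP[] := IA01 z.
    - by apply/measurable_EFinP; exact: measurable_funM.
    - by apply: emeasurable_funD; apply/measurable_EFinP => //; apply: measurable_funM => //;
        exact/measurable_EFinP.
    - by move=> z _; rewrite -EFinD lee_fin.
  rewrite ge0_integralD; [|by []| | | |]; first last.
  - by apply/measurable_EFinP; apply: measurable_funM => //; exact/measurable_EFinP.
  - by move=> z _; rewrite lee_fin mulr_ge0.
  - exact/measurable_EFinP.
  - by move=> z _; rewrite lee_fin; have /andP[] := It0 z.
  rewrite leeD2l//; apply: le_trans rn_le.
  rewrite (integral_has_density (mZn n) (Zn0 n) (hpi n) mrn)//.
have step2 : (\int[Qn n]_z (IA z * tn n z)%:E <=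
    \int[Q]_z (IA z * tn n z)%:E + (eps / 4)%:E)%E.
  apply: le_trans (tv_close_integral (QnQ n) mIt It0) _.
  by rewrite leeD2l// lee_fin.
have step3 : (\int[Q]_z (IA z * tn n z)%:E <=
    \int[Q]_(z in A) (Z z)%:E + (eps / 4)%:E)%E.
  rewrite [X in (_ <= X + _)%E]integral_mkcond epatch_indic.
  apply: (@le_trans _ _ (\int[Q]_z ((Z z)%:E * (\1_A z)%:E + (wn n z)%:E))%E).
    apply: ge0_le_integral => //.
    - by move=> z _; rewrite lee_fin; have /andP[] := It0 z.
    - exact/measurable_EFinP.
    - apply: emeasurable_funD; last exact/measurable_EFinP.
      by apply: emeasurable_funM; exact/measurable_EFinP.
    - move=> z _; rewrite -EFinM -EFinD lee_fin -/(IA z).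
      have /andP[a b] := IA01 z; have /andP[t0 tM] := tn0 n z.
      have /andP[w0 wM] := wn0 n z.
      have tw : tn n z <= Z z + wn n z by rewrite -lerBlDl /wn le_max lexx.
      rewrite mulrC; apply: (@le_trans _ _ ((Z z + wn n z) * IA z)).
        by rewrite ler_wpM2r.
      by rewrite mulrDl lerD2l ler_piMr.
  rewrite ge0_integralD; [|by []| | | |]; first last.
  - exact/measurable_EFinP.
  - by move=> z _; rewrite lee_fin; have /andP[] := wn0 n z.
  - by apply: emeasurable_funM; exact/measurable_EFinP.
  - by move=> z _; rewrite mule_ge0 ?lee_fin.
  by rewrite leeD2l.
apply: (le_trans step1); apply: le_trans (leeD2r _ (le_trans step2 (leeD2r _ step3))) _.
move: (\int[Q]_(z in A) (Z z)%:E)%E => X.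
rewrite -!addeA -!EFinD; apply: leeD2l; rewrite lee_fin; lra.
Qed.


(** The bound [pi_le] for the whole space shows that [Z] has integral at least [1],
so that [Z] is the density of a probability; the same bound for all sets is then
convergence in total variation. *)
Lemma tv_limit : exists P : probability (T1 * T2)%type R,
  [/\ has_density P (mu \x nu)%E Z, coupling mu nu P & tv_cvg pi_ P].
Proof.
have Z1 : (\int[Q]_z (Z z)%:E = 1)%E.
  apply/le_anti; rewrite Z_le1/=; apply/lee_addgt0Pr => eps eps0.
  have [N _ /(_ N (leqnn N))] := pi_le eps0.
  by move=> /(_ _ measurableT); rewrite probability_setT.
have [P hP] := probability_of_density mZ Z0 Z1.
have piP : tv_cvg pi_ P.
  apply: cvge0_small => [n|eps eps0]; first exact: tv_dist_ge0.
  apply: filterS (pi_le eps0) => n H; apply: tv_dist_le => A mA.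
  by rewrite hP//; exact: H.
have mu_tv : tv_cvg mu_ mu by apply/tv_cvgP; exists e.
have nu_tv : tv_cvg nu_ nu by apply/tv_cvgP; exists e.
exists P; split => //; split => A mA.
- have mA1 : measurable (fst @^-1` A : set (T1 * T2)).
    by rewrite -[X in measurable X]setTI; exact: measurable_fst.
  apply: (cvg_unique _ (tv_cvg_set piP mA1)) => //.
  apply: cvg_trans (tv_cvg_set mu_tv mA); apply: near_eq_cvg; apply: nearW => n.
  exact/esym/(cpi n).1.
- have mA2 : measurable (snd @^-1` A : set (T1 * T2)).
    by rewrite -[X in measurable X]setTI; exact: measurable_snd.
  apply: (cvg_unique _ (tv_cvg_set piP mA2)) => //.
  apply: cvg_trans (tv_cvg_set nu_tv mA); apply: near_eq_cvg; apply: nearW => n.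
  exact/esym/(cpi n).2.
Qed.

End tv_limit.

(** * Subsequential limits and conclusion *)

Section subsequential_limit.
Context d1 d2 (T1 : measurableType d1) (T2 : measurableType d2) (R : realType).
Context (c : T1 * T2 -> R) (D1 : nat -> T1) (D2 : nat -> T2).
Hypotheses (mc : measurable_fun setT c) (c0 : forall z, 0 <= c z).
Hypothesis cD1 : forall x, exists s : nat -> nat, forall y,
  c (D1 (s n), y) @[n --> \oo] --> c (x, y).
Hypothesis cD2 : forall y, exists s : nat -> nat, forall x,
  c (x, D2 (s n)) @[n --> \oo] --> c (x, y).

(** Uniqueness is part of the conclusion, as it is what makes the limits along
different subsequences agree. *)
Lemma optimal_subseq_limit
    (mu_ : nat -> probability T1 R) (nu_ : nat -> probability T2 R)
    (mu : probability T1 R) (nu : probability T2 R)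
    (pi_ : nat -> probability (T1 * T2)%type R)
    (f : nat -> T1 -> R) (g : nat -> T2 -> R) (K : R) :
  tv_cvg mu_ mu -> tv_cvg nu_ nu ->
  (forall n, coupling (mu_ n) (nu_ n) (pi_ n)) ->
  (forall n, potentials (mu_ n) (nu_ n) c (pi_ n) (f n) (g n)) ->
  (forall n, (\int[mu_ n]_x (Num.max (f n x) 0)%:E <= K%:E)%E) ->
  (forall n, (\int[nu_ n]_y (Num.max (g n y) 0)%:E <= K%:E)%E) ->
  exists (phi : nat -> nat) (P : probability (T1 * T2)%type R),
  [/\ forall k, (k <= phi k)%N,
      optimal_coupling mu nu c P /\ (eot_cost mu nu c P < +oo)%E,
      forall rho, optimal_coupling mu nu c rho ->
        forall A, measurable A -> rho A = P A
    & tv_cvg (pi_ \o phi) P].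
Proof.
move=> /tv_cvgP[e1 [e10 mu_cvg]] /tv_cvgP[e2 [e20 nu_cvg]] cpi pot fK gK.
pose e n := e1 n + e2 n.
have e0 : e n @[n --> \oo] --> (0 : R).
  by rewrite -[X in _ --> X](addr0 0); exact: cvgD.
have muc n : tv_close (e n) (mu_ n) mu.
  move=> A mA; apply: le_trans (mu_cvg n A mA) _.
  by rewrite leeD2l// lee_fin lerDl (tv_close_ge0 (nu_cvg n)).
have nuc n : tv_close (e n) (nu_ n) nu.
  move=> A mA; apply: le_trans (nu_cvg n A mA) _.
  by rewrite leeD2l// lee_fin lerDr (tv_close_ge0 (mu_cvg n)).
have mf n : measurable_fun setT (f n) by have [] := pot n.
have mg n : measurable_fun setT (g n) by have [] := pot n.
have hpi n : has_density (pi_ n) (mu_ n \x nu_ n)%E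
    (fun z => expR (f n z.1 + g n z.2 - c z)).
  have [_ _ aeZ] := pot n.
  by apply: ae_has_density aeZ; exact: measurable_potentials.
have L1 n := potentials_L1 mc c0 (mf n) (mg n) (cpi n) (hpi n) (fK n) (gK n).
have S1 n := potentials_marginal1 mc (mf n) (mg n) (cpi n) (hpi n).
have S2 n := potentials_marginal2 mc (mf n) (mg n) (cpi n) (hpi n).
have [phi1 [phi1k [F mF fF]]] := potential_ae_subseq mc c0 cD1 e0 muc nuc mf mg
  (fun n => (L1 n).1) (fun n => (L1 n).2) S1 S2.
(* the same argument with the two spaces exchanged, along [phi1] *)
pose c' z := c (z.2, z.1).
have mc' : measurable_fun setT (c' : T2 * T1 -> R).
  by apply: (measurableT_comp mc); exact: measurable_swap.
have e0' : e (phi1 n) @[n --> \oo] --> (0 : R) by exact: cvg_subseq phi1k e0.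
have S1' n : {ae nu_ (phi1 n), forall y, (\int[mu_ (phi1 n)]_x
    (expR (g (phi1 n) y + f (phi1 n) x - c' (y, x)))%:E = 1)%E}.
  apply: filterS (S2 (phi1 n)) => y /= <-.
  by apply: eq_integral => x _; rewrite (addrC (g _ y)).
have S2' n : {ae mu_ (phi1 n), forall x, (\int[nu_ (phi1 n)]_y
    (expR (g (phi1 n) y + f (phi1 n) x - c' (y, x)))%:E = 1)%E}.
  apply: filterS (S1 (phi1 n)) => x /= <-.
  by apply: eq_integral => y _; rewrite (addrC (g _ y)).
have [phi2 [phi2k [G mG gG]]] := @potential_ae_subseq _ _ _ _ _ c' D2 mc'
  (fun z => c0 _) cD2 (nu_ \o phi1) (mu_ \o phi1) nu mu (e \o phi1) e0'
  (fun n => nuc (phi1 n)) (fun n => muc (phi1 n)) (g \o phi1) (f \o phi1)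
  (fun n => mg (phi1 n)) (fun n => mf (phi1 n)) (K + K + 1)
  (fun n => (L1 (phi1 n)).2) (fun n => (L1 (phi1 n)).1) S1' S2'.
pose phi := phi1 \o phi2.
have phik k : (k <= phi k)%N by exact: leq_trans (phi2k k) (phi1k _).
have fF' : {ae mu, forall x, f (phi k) x @[k --> \oo] --> F x}.
  by apply: filterS fF => x; apply: (cvg_subseq phi2k).
have e0phi : e (phi n) @[n --> \oo] --> (0 : R) by exact: cvg_subseq phik e0.
have lim := tv_limit mc c0 e0phi (fun n => muc (phi n)) (fun n => nuc (phi n))
  (fun n => mf (phi n)) (fun n => mg (phi n)) (fun n => cpi (phi n))
  (fun n => hpi (phi n)) (fun n => (L1 (phi n)).1) (fun n => (L1 (phi n)).2)
  mF mG fF' gG.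
have iF := tv_limit_integrable1 e0phi (fun n => muc (phi n)) (fun n => mf (phi n))
  (fun n => (L1 (phi n)).1) mF fF'.
have iG := tv_limit_integrable2 e0phi (fun n => nuc (phi n)) (fun n => mg (phi n))
  (fun n => (L1 (phi n)).2) mG gG.
have [P [hP cP piP]] := lim.
have costP := eot_cost_potentials mc c0 iF iG cP hP.
have opt rho (crho : coupling mu nu rho) := eot_cost_ge_potentials mc c0 iF iG crho hP.
have valE : eot_value mu nu c = eot_cost mu nu c P.
  apply/le_anti/andP; split; first by apply: ereal_inf_lbound; exists P.
  by apply: le_ereal_inf_tmp => _ [rho crho <-]; rewrite costP; have [] := opt rho crho.
exists phi, P; split => //.
- split; first by split.
  rewrite costP ltey_eq; apply/orP; left.
  by rewrite fin_numD !integrable_fin_num.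
- move=> rho [crho rho_val] A mA; have [_] := opt rho crho; apply => //.
  by rewrite rho_val valE costP.
Qed.

End subsequential_limit.

Theorem corollary2p6 (R : realType) (X Y : ptopologicalType)
  (polX : polish R X) (polY : polish R Y)
  (c : (X * Y)%type -> R) (c_cont : continuous c) (c_ge0 : forall z, 0 <= c z)
  (mu_ : nat -> probability (borel X) R) (nu_ : nat -> probability (borel Y) R)
  (C_fin : forall n, (eot_value (mu_ n) (nu_ n) c < +oo)%E)
  (pi_ : nat -> probability (borel X * borel Y)%type R)
  (pi_opt : forall n, optimal_coupling (mu_ n) (nu_ n) c (pi_ n))
  (f : nat -> borel X -> R) (g : nat -> borel Y -> R)
  (fg_pot : forall n, potentials (mu_ n) (nu_ n) c (pi_ n) (f n) (g n))
  (f_bnd : (ereal_sup (range (fun n =>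
     \int[mu_ n]_x (Num.max (f n x) 0)%:E)) < +oo)%E)
  (g_bnd : (ereal_sup (range (fun n =>
     \int[nu_ n]_y (Num.max (g n y) 0)%:E)) < +oo)%E)
  (mu : probability (borel X) R) (nu : probability (borel Y) R)
  (mu_cvg : tv_cvg mu_ mu) (nu_cvg : tv_cvg nu_ nu)
  (mu_dom : forall n, mu `<< mu_ n) (nu_dom : forall n, nu `<< nu_ n) :
  [/\ (eot_value mu nu c < +oo)%E,
      exists pi, optimal_coupling mu nu c pi
    & forall pi, optimal_coupling mu nu c pi -> tv_cvg pi_ pi].
Proof.
have mc := continuous_measurable_prod polX polY c_cont.
have [D1 D1P] := polish_dense_cvg polX.
have [D2 D2P] := polish_dense_cvg polY.
have cD1 (x : borel X) : exists s : nat -> nat, forall y : borel Y,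
    c (D1 (s n), y) @[n --> \oo] --> c (x, y).
  have [s sx] := D1P x; exists s => y.
  apply: (@cvg_comp _ _ _ (fun n => (D1 (s n), y)) c _ _ _ _ (c_cont (x, y))).
  by apply: cvg_pair => //; exact: cvg_cst.
have cD2 (y : borel Y) : exists s : nat -> nat, forall x : borel X,
    c (x, D2 (s n)) @[n --> \oo] --> c (x, y).
  have [s sy] := D2P y; exists s => x.
  apply: (@cvg_comp _ _ _ (fun n => (x, D2 (s n))) c _ _ _ _ (c_cont (x, y))).
  by apply: cvg_pair => //; exact: cvg_cst.
have [K [fK gK]] : exists K : R,
    (forall n, (\int[mu_ n]_x (Num.max (f n x) 0)%:E <= K%:E)%E) /\
    (forall n, (\int[nu_ n]_y (Num.max (g n y) 0)%:E <= K%:E)%E).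
  have bnd (u : nat -> \bar R) : (forall n, 0 <= u n)%E ->
      (ereal_sup (range u) < +oo)%E -> exists2 K : R, 0 <= K & forall n, (u n <= K%:E)%E.
    move=> u0 uoo.
    have uK n : (u n <= ereal_sup (range u))%E by apply: ereal_sup_ubound; exists n.
    have sfin : ereal_sup (range u) \is a fin_num.
      by rewrite ge0_fin_numE//; apply: le_trans (u0 0) (uK 0).
    exists (fine (ereal_sup (range u))).
      by rewrite fine_ge0//; apply: le_trans (u0 0) (uK 0).
    by move=> n; rewrite fineK.
  have [n|K1 K10 K1P] := bnd _ _ f_bnd.
    by apply: integral_ge0 => x _; rewrite lee_fin le_max lexx orbT.
  have [n|K2 K20 K2P] := bnd _ _ g_bnd.
    by apply: integral_ge0 => x _; rewrite lee_fin le_max lexx orbT.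
  exists (K1 + K2); split => n.
    by apply: le_trans (K1P n) _; rewrite lee_fin lerDl.
  by apply: le_trans (K2P n) _; rewrite lee_fin lerDr.
have sub (psi : nat -> nat) (psik : forall k, (k <= psi k)%N) :=
  @optimal_subseq_limit _ _ (borel X) (borel Y) R c D1 D2 mc c_ge0 cD1 cD2
    (mu_ \o psi) (nu_ \o psi) mu nu (pi_ \o psi) (f \o psi) (g \o psi) K
    (cvg_subseq psik mu_cvg) (cvg_subseq psik nu_cvg)
    (fun n => (pi_opt (psi n)).1) (fun n => fg_pot (psi n))
    (fun n => fK (psi n)) (fun n => gK (psi n)).
have [_ [P [_ [Popt Poo] _ _]]] := sub id (fun k => leqnn k).
split; first by rewrite -Popt.2.
  by exists P.
move=> pi opt_pi; apply: cvge0_small => [n|eps eps0]; first exact: tv_dist_ge0.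
(* otherwise some subsequence stays at distance more than [eps] from [pi], but a
   further subsequence of it converges to [pi] by uniqueness *)
apply: contrapT => Hnot.
have /choice[psi psiP] : forall N, exists n, (N <= n)%N /\ (eps%:E < tv_dist (pi_ n) pi)%E.
  move=> N; apply: contrapT => HN; apply: Hnot; exists N => // n /= Nn.
  by rewrite leNgt; apply/negP => Hn; apply: HN; exists n.
have psik k : (k <= psi k)%N by have [] := psiP k.
have [phi [P' [_ _ uniq /tv_cvgP[e [e0 piP']]]]] := sub psi psik.
have /cvgrPdist_le/(_ _ eps0)[N _ /(_ N (leqnn N))] := e0.
rewrite sub0r normrN => eN; have [_] := psiP (phi N).
rewrite ltNge => /negP; apply; apply: tv_dist_le => A mA.
rewrite (uniq pi opt_pi A mA); apply: le_trans (piP' N A mA) _.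
by rewrite leeD2l// lee_fin (le_trans (ler_norm _) eN).
Qed.
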